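(* Let $d\ge1$ be an integer, let $1<p<+\infty$, let $c>0$, let $A\in\mathbb{R}^{d\times d}$ be a symmetric positive semi-definite matrix, and let $\beta\in\mathbb{R}$. Let $\Omega=\,]0,+\infty[$ if $d=1$ and $\Omega=\mathbb{R}^d$ if $d\ge 2$, and let $\mu$ be the Borel measure $d\mu=\rho(x)\,dx$ with density $\rho(x)=c\exp\big(-\tfrac1p (x^{t}Ax)^{p/2}\big)$. Then $$\Big(\frac{|d-(p+\beta)|}{p}\Big)^{p}\int_{\Omega}\frac{|u|^{p}}{|x|^{p+\beta}}\,d\mu\le\int_{\Omega}\frac{|\nabla u|^{p}}{|x|^{\beta}}\,d\mu+\Big(\frac{|d-(p+\beta)|}{p}\Big)^{p-1}\operatorname{sgn}(d-(p+\beta))\int_{\Omega}|u|^{p}\,\frac{(x^{t}Ax)^{p/2}}{|x|^{p+\beta}}\,d\mu$$ for all $u\in C^{\infty}_{c,0}$. Moreover, if either $A=0$ or $A$ is positive definite, then the constant $\big(\tfrac{|d-(p+\beta)|}{p}\big)^{p}$ is optimal (including the case $p+\beta=d$); that is, for no $\lambda>\big(\tfrac{|d-(p+\beta)|}{p}\big)^{p}$ does the inequality obtained by replacing the constant in front of the left-hand integral by $\lambda$ (leaving the right-hand side unchanged) hold for all $u\in C^{\infty}_{c,0}$.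
   Context: $C^{\infty}_{c,0}$ denotes $C_c^\infty(]0,+\infty[)$ if $d=1$ and $C_c^\infty(\mathbb{R}^d\setminus\{0\})$ if $d\ge2$ (infinitely differentiable functions with compact support in the indicated open set). $|x|$ is the Euclidean norm, $x^t$ the transpose of $x$, and $\operatorname{sgn}$ is the sign function with $\operatorname{sgn}(0)=0$. When $p+\beta=d$ the last term on the right-hand side is read as $0$. *)

(* Defs.v *)
From HB Require Import structures.
From mathcomp Require Import all_boot all_order all_algebra.
From mathcomp Require Import all_classical all_reals all_analysis measurable_realfun.

Set Implicit Arguments.
Unset Strict Implicit.
Unset Printing Implicit Defensive.

Import Order.TTheory GRing.Theory Num.Theory.
Import numFieldNormedType.Exports.

Local Open Scope classical_set_scope.
Local Open Scope ring_scope.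

Section borel_rV.
Context {R : realType} {d : nat}.

HB.instance Definition _ := @isMeasurable.Build
  (sigma_display (@open 'rV[R]_d)) 'rV[R]_d
  <<s @open 'rV[R]_d >>
  (@sigma_algebra0 _ setT _) (@sigma_algebraC _ _) (@sigma_algebra_bigcup _ setT _).

Lemma open_measurable_rV (O : set 'rV[R]_d) : open O -> measurable O.
Proof. exact: sub_sigma_algebra. Qed.

Lemma continuous_measurable_rV (f : 'rV[R]_d -> R) :
  continuous f -> measurable_fun [set: 'rV[R]_d] f.
Proof.
move=> /continuousP cf; apply: (measurability _ (RGenOpens.measurableE R)).
move=> _ [_ [a [b ->] <-]]; rewrite setTI; apply: open_measurable_rV.
exact/cf/interval_open.
Qed.

Lemma measurable_coord_rV (i : 'I_d) :
  measurable_fun [set: 'rV[R]_d] (fun v : 'rV[R]_d => v ord0 i).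
Proof. by apply: continuous_measurable_rV; exact: coord_continuous. Qed.

Lemma measurable_fun_rV d' (T : measurableType d') (f : T -> 'rV[R]_d) :
  (forall i, measurable_fun [set: T] (fun t => f t ord0 i)) ->
  measurable_fun [set: T] f.
Proof.
move=> mf; apply: (@measurability _ _ _ _ _ _ (@open 'rV[R]_d)) => //.
move=> _ [U oU <-]; rewrite setTI.
pose box (q : 'rV[rat]_d) (n : nat) : set 'rV[R]_d :=
  [set v | forall i, ball (ratr (q ord0 i) : R) n.+1%:R^-1 (v ord0 i)].
have -> : f @^-1` U = \bigcup_(qn : 'rV[rat]_d * nat)
    (if `[< box qn.1 qn.2 `<=` U >] then f @^-1` box qn.1 qn.2 else set0).
  apply/seteqP; split=> [t Ut|t [[q n] _]/=]; last first.
    by case: ifPn => // /asboolP + h; exact.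
  have /nbhs_ballP[e /= e0 eU] : nbhs (f t) U by exact: open_nbhs_nbhs.
  have [n nP] : exists n, n.+1%:R^-1 < e / 2.
    by exists (Num.truncn (e / 2)^-1); rewrite invf_plt ?posrE ?divr_gt0 ?truncnS_gt.
  have qP i : exists q : rat, ball (ratr q : R) n.+1%:R^-1 (f t ord0 i).
    have : f t ord0 i - n.+1%:R^-1 < f t ord0 i + n.+1%:R^-1 :> R.
      by rewrite ltrBlDr -addrA ltrDl addr_gt0// invr_gt0.
    move=> /rat_in_itvoo[q]; rewrite in_itv/= => /andP[q1 q2]; exists q.
    by rewrite /ball/= ltr_distlC ltrBlDr q2/= -ltrBlDr q1.
  pose q := \row_i projT1 (cid (qP i)).
  have qf i : ball (ratr (q ord0 i) : R) n.+1%:R^-1 (f t ord0 i).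
    by rewrite mxE; case: cid.
  exists (q, n) => //=; case: ifPn => // /asboolP[] v bv; apply: eU; split => //.
  move=> i j; rewrite ord1 [e](splitr e).
  apply: (@ball_triangle _ _ (ratr (q ord0 j) : R^o)).
    by apply: ball_sym; apply: le_ball (qf j); exact: ltW.
  by apply: le_ball (bv j); exact: ltW.
apply: countable_bigcupT_measurable => [|qn]; first exact: countableP.
case: ifPn => // _.
have -> : f @^-1` box qn.1 qn.2 = \bigcap_(i in [set: 'I_d])
    ((fun t => f t ord0 i) @^-1` ball (ratr (qn.1 ord0 i) : R) qn.2.+1%:R^-1).
  by apply/seteqP; split => [t h i _|t h i]; apply: h.
apply: fin_bigcap_measurable => // i _; rewrite -[X in measurable X]setTI.
apply: mf => //; apply: open_measurable; exact: ball_open.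
Qed.

End borel_rV.

Section lebesgue_rV.
Context {R : realType}.
Local Open Scope ereal_scope.

Definition rV_cons d (xv : R * 'rV[R]_d) : 'rV[R]_d.+1 :=
  row_mx (const_mx xv.1 : 'rV[R]_1) xv.2.

Lemma rV_consE0 d (xv : R * 'rV[R]_d) : rV_cons xv ord0 ord0 = xv.1.
Proof.
have -> : (ord0 : 'I_d.+1) = lshift d (ord0 : 'I_1) by exact/val_inj.
by rewrite /rV_cons; apply: etrans (row_mxEl _ _ _ _) _; rewrite mxE.
Qed.

Lemma rV_consES d (xv : R * 'rV[R]_d) i :
  rV_cons xv ord0 (rshift 1 i : 'I_d.+1) = xv.2 ord0 i.
Proof. exact: row_mxEr. Qed.

Lemma measurable_rV_cons d :
  measurable_fun [set: R * 'rV[R]_d] (@rV_cons d).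
Proof.
apply: measurable_fun_rV => i.
case: (@splitP 1 d i) => j ij.
  rewrite [X in measurable_fun _ X](_ : _ = fst); first exact: measurable_fst.
  apply/funext => xv; rewrite -rV_consE0; congr (rV_cons _ _ _).
  by apply/val_inj => /=; move: ij; rewrite ord1 => ->.
rewrite [X in measurable_fun _ X](_ : _ = (fun v : 'rV[R]_d => v ord0 j) \o snd).
  by apply: measurableT_comp; [exact: measurable_coord_rV|exact: measurable_snd].
apply/funext => xv/=; rewrite -rV_consES; congr (rV_cons _ _ _).
by apply/val_inj => /=; rewrite ij.
Qed.

Section step.
Variables (d : nat) (mu : {sigma_finite_measure set 'rV[R]_d -> \bar R}).

Definition lebesgue_rV_step : set 'rV[R]_d.+1 -> \bar R :=
  pushforward (@lebesgue_measure R \x mu) (@rV_cons d).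


Let step0 : lebesgue_rV_step set0 = 0.
Proof. by rewrite /lebesgue_rV_step /pushforward preimage_set0 measure0. Qed.

Let step_ge0 A : 0 <= lebesgue_rV_step A.
Proof. by rewrite /lebesgue_rV_step /pushforward measure_ge0. Qed.

Let step_sigma_additive : semi_sigma_additive lebesgue_rV_step.
Proof.
move=> F mF tF mUF.
have mf := @measurable_rV_cons d.
rewrite /lebesgue_rV_step /pushforward preimage_bigcup.
apply: measure_semi_sigma_additive.
- by move=> n; rewrite -[X in measurable X]setTI; exact: mf.
- apply/trivIsetP => /= i j _ _ ij; rewrite -preimage_setI.
  by move/trivIsetP : tF => /(_ _ _ _ _ ij) ->//; rewrite preimage_set0.
- by rewrite -preimage_bigcup -[X in measurable X]setTI; exact: mf.
Qed.

HB.instance Definition _ := isMeasure.Build _ _ _ lebesgue_rV_step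
  step0 step_ge0 step_sigma_additive.

Let step_sigma_finite : sigma_finite setT lebesgue_rV_step.
Proof.
have /sigma_finiteP[E [ET ndE mE]] := sigma_finiteT (@lebesgue_measure R).
have /sigma_finiteP[F [FT ndF mF]] := sigma_finiteT mu.
pose G n : set 'rV[R]_d.+1 :=
  [set v : 'rV[R]_d.+1 | E n (v ord0 ord0)] `&`
  [set v : 'rV[R]_d.+1 | F n (rsubmx (v : 'rV[R]_(1 + d)))].
exists G.
  apply/seteqP; split=> // v _.
  have : [set: R] (v ord0 ord0) by [].
  rewrite ET => -[i _ Ei].
  have : [set: 'rV[R]_d] (rsubmx (v : 'rV[R]_(1 + d))) by [].
  rewrite FT => -[j _ Fj].
  exists (maxn i j) => //; split.
    by have /subsetPset := ndE _ _ (leq_maxl i j); exact.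
  by have /subsetPset := ndF _ _ (leq_maxr i j); exact.
move=> n; split.
  apply: measurableI.
    rewrite -[X in measurable X]setTI.
    by apply: (@measurable_coord_rV R d.+1 ord0) => //; have [] := mE n.
  rewrite -[X in measurable X]setTI.
  suff mr : measurable_fun [set: 'rV[R]_d.+1]
      (fun v : 'rV[R]_d.+1 => rsubmx (v : 'rV[R]_(1 + d))).
    by apply: mr => //; have [] := mF n.
  apply: measurable_fun_rV => i.
  rewrite [X in measurable_fun _ X](_ : _ = fun v : 'rV[R]_d.+1 => v ord0 (rshift 1 i : 'I_d.+1)).
    exact: measurable_coord_rV.
  by apply/funext => v; rewrite mxE.
rewrite /= /lebesgue_rV_step /pushforward.
have -> : @rV_cons d @^-1` G n = E n `*` F n.
  by apply/seteqP; split => -[x v] /=; rewrite /G/= rV_consE0 /rV_cons row_mxKr.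
rewrite product_measure1E; [|by have [] := mE n|by have [] := mF n].
have [_ En] := mE n; have [_ Fn] := mF n.
by apply: lte_mul_pinfty => //; rewrite ge0_fin_numE.
Qed.

HB.instance Definition _ := Measure_isSigmaFinite.Build _ _ _ lebesgue_rV_step
  step_sigma_finite.

End step.

Fixpoint lebesgue_rV d : {sigma_finite_measure set 'rV[R]_d -> \bar R} :=
  match d with
  | 0%N => \d_(0%R : 'rV[R]_0)
  | d'.+1 => lebesgue_rV_step (lebesgue_rV d')
  end.

End lebesgue_rV.

Section euclidean.
Context {R : realType} {d : nat}.
Implicit Types (x : 'rV[R]_d) (A : 'M[R]_d) (u : 'rV[R]_d -> R).

(* the canonical norm on 'rV[R]_d is the sup norm *)
Definition enorm x : R := Num.sqrt (\sum_(i < d) x ord0 i ^+ 2).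

(* vectors are rows, so this is x^t A x in column notation *)
Definition quad A x : R := (x *m A *m x^T) ord0 ord0.

Definition possemidefmx A := A^T = A /\ forall x, 0 <= quad A x.

Definition posdefmx A := A^T = A /\ forall x, x != 0 -> 0 < quad A x.

Definition partial (i : 'I_d) u : 'rV[R]_d -> R :=
  fun x => 'D_(delta_mx ord0 i) u x.

Definition grad u x : 'rV[R]_d := \row_i partial i u x.

Definition smooth u := forall s : seq 'I_d,
  continuous (foldr partial u s) /\
  forall i x, derivable (foldr partial u s) x (delta_mx ord0 i).

(* an element of C_c^oo(U) is identified with its extension by 0 to R^d *)
Definition test_function (U : set 'rV[R]_d) u :=
  [/\ smooth u, compact (closure [set x | u x != 0])
    & closure [set x | u x != 0] `<=` U].

End euclidean.

Section hardy.
Context {R : realType} (d : nat).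
Implicit Types (p c beta lambda : R) (A : 'M[R]_d) (u : 'rV[R]_d -> R).

Definition half_line : set 'rV[R]_d := [set x | forall i, 0 < x ord0 i].

Definition Omega : set 'rV[R]_d := if d == 1%N then half_line else setT.

Definition Cc0 u := test_function (if d == 1%N then half_line else ~` [set 0]) u.

Definition rho p c A (x : 'rV[R]_d) : R :=
  c * expR (- (p^-1 * quad A x `^ (p / 2))).

Definition mu_rho p c A (B : set 'rV[R]_d) : \bar R :=
  (\int[lebesgue_rV d]_(x in B) (rho p c A x)%:E)%E.

Lemma measurable_quad A : measurable_fun setT (quad A).
Proof.
rewrite (_ : quad A = fun x => \sum_j (\sum_i x ord0 i * A i j) * x ord0 j).
  apply: measurable_sum => j; apply: measurable_funM.
    apply: measurable_sum => i; apply: measurable_funM => //.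
    exact: measurable_coord_rV.
  exact: measurable_coord_rV.
by apply/funext => x; rewrite /quad mxE; apply: eq_bigr => j _; rewrite !mxE.
Qed.

Lemma measurable_rho p c A : measurable_fun setT (rho p c A).
Proof.
apply: measurable_funM => //; apply: measurableT_comp => //.
apply: measurableT_comp => //; apply: measurable_funM => //.
by apply: (measurableT_comp (measurable_powR _)); exact: measurable_quad.
Qed.

Section mu_rho_measure.
Variables (p c : R) (A : 'M[R]_d).
Hypothesis c0 : 0 <= c.

Lemma rho_ge0 x : 0 <= rho p c A x.
Proof. by rewrite mulr_ge0// expR_ge0. Qed.

Let mu_rho0 : mu_rho p c A set0 = 0%E.
Proof. exact: integral_set0. Qed.

Let mu_rho_ge0 B : (0 <= mu_rho p c A B)%E.
Proof. by apply: integral_ge0 => x _; rewrite lee_fin rho_ge0. Qed.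

Let mu_rho_sigma_additive : semi_sigma_additive (mu_rho p c A).
Proof.
move=> /= F mF tF mUF; rewrite /mu_rho ge0_integral_bigcup//=; last 2 first.
  by apply/measurable_EFinP; apply: measurable_funTS; exact: measurable_rho.
  by move=> x _; rewrite lee_fin rho_ge0.
apply: is_cvg_ereal_nneg_natsum_cond => n _ _.
by apply: integral_ge0 => x _; rewrite lee_fin rho_ge0.
Qed.

HB.instance Definition _ := isMeasure.Build _ _ _ (mu_rho p c A)
  mu_rho0 mu_rho_ge0 mu_rho_sigma_additive.

End mu_rho_measure.

Definition hardy_constant p beta : R := `|d%:R - (p + beta)| / p.

Local Open Scope ereal_scope.

(* Since u vanishes near 0, the integrands are 0 at x = 0, where the division
   is by powR 0 _. When p + beta = d, Num.sg 0 = 0 kills the last term. *)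
Definition hardy_inequality p c beta A lambda u : Prop :=
  lambda%:E * \int[mu_rho p c A]_(x in Omega)
     (`|u x| `^ p / enorm x `^ (p + beta))%R%:E
  <= \int[mu_rho p c A]_(x in Omega)
       (enorm (grad u x) `^ p / enorm x `^ beta)%R%:E
   + (hardy_constant p beta `^ (p - 1)
        * Num.sg (d%:R - (p + beta)))%R%:E
     * \int[mu_rho p c A]_(x in Omega)
       (`|u x| `^ p * quad A x `^ (p / 2) / enorm x `^ (p + beta))%R%:E.

End hardy.

(* Main.v *)
Require Import Defs.
From HB Require Import structures.
From mathcomp Require Import all_boot all_order all_algebra.
From mathcomp Require Import all_classical all_reals all_analysis.
From mathcomp Require Import measurable_realfun ring lra.

(** The inequality rests on one vector field. With [F = |u|^p |x|^(-(p + beta)) rho],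
    the divergence of [x |-> F(x) x] is

      [ (p |u|^(p-1) sgn(u) (x . grad u)
         + (d - (p + beta) - (x^t A x)^(p/2)) |u|^p) |x|^(-(p + beta)) rho ],

    because [x . grad rho = - (x^t A x)^(p/2) rho], and its integral is zero
    ([integral_radial_divergence]). Instead of a divergence theorem, only the
    behaviour of Lebesgue measure under dilations is used
    ([integral_lebesgue_rV_dilation]): the integral of [s^d F(s x)] does not depend
    on [s], and its derivative at [s = 1] is the integral of the divergence. Young's
    inequality bounds the term containing [x . grad u] by [|grad u|^p] and a
    multiple of [|u|^p] ([hardy_pointwise]), and integration gives the inequality.
    The argument is the same in all dimensions, because the half-line and the whole
    space are both cones.

    For optimality the test functions are [|x|^(-(d - (p + beta))/p)] multiplied by
    a cutoff that equals [1] on [n] consecutive dyadic annuli and falls to [0] on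
    one dyadic annulus on either side. For them [|u|^p |x|^(-(p + beta))] and
    [|grad u|^p |x|^(-beta)] are, on the [n] annuli, [|x|^(-d)] and [C^p |x|^(-d)],
    where [C] is the Hardy constant without its exponent. Since [|x|^(-d) dx] is
    invariant under dilations, every dyadic annulus has the same mass
    ([integral_log_density_dyadic]), and the two transition annuli become negligible
    as [n] grows. The density [rho] and the term with [x^t A x] are controlled by
    placing all annuli close to the origin, where [rho] is close to [c] and
    [x^t A x] is close to [0] ([hardy_test_estimate], [hardy_constant_optimal]).

    The test functions must be smooth in the sense that all iterated partial
    derivatives exist and are continuous. Two inductively defined classes of
    functions, one on the line and one on row vectors, are closed under
    differentiation by construction and contain what is needed
    ([cinf_derive], [cinf_rV_smooth]). *)

Import Order.TTheory GRing.Theory Num.Theory.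
Import numFieldNormedType.Exports.

Local Open Scope classical_set_scope.
Local Open Scope ring_scope.

Set Implicit Arguments.
Unset Strict Implicit.
Unset Printing Implicit Defensive.

(** * Dilations and boxes for Lebesgue measure on row vectors *)

Section dilation.
Context {R : realType}.
Local Open Scope ereal_scope.

(** Both sides come from measures that agree on half-open intervals: rescaling
    the pushforward of Lebesgue measure under multiplication by [t] gives
    Lebesgue measure back. *)
Lemma lebesgue_measure_dilation (t : R) (t0 : (0 < t)%R) (f : R -> \bar R) :
  measurable_fun setT f -> (forall x, 0 <= f x) ->
  \int[lebesgue_measure]_x f (t * x)%R =
  t^-1%:E * \int[lebesgue_measure]_x f x.
Proof.
move=> mf f0.
have mt : measurable_fun setT ( *%R t : measurableTypeR R -> measurableTypeR R).
  exact: mulrl_measurable.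
pose tn := NngNum (ltW t0).
have lebE (A : set (measurableTypeR R)) : measurable A -> lebesgue_measure A =
    mscale tn (pushforward (@lebesgue_measure R)
      ( *%R t : measurableTypeR R -> measurableTypeR R)) A.
  apply: (@lebesgue_measure_unique R (mscale tn (pushforward (@lebesgue_measure R)
    ( *%R t : measurableTypeR R -> measurableTypeR R)))) => _ [[a b] _ <-].
  rewrite /mscale /= /pushforward.
  rewrite [X in _ = _ * lebesgue_measure X](_ : _ =
      `](t^-1 * a)%R, (t^-1 * b)%R]%classic :> set R); last first.
    apply/seteqP; split=> x /=; rewrite !in_itv/=;
      by rewrite ltr_pdivrMl// ler_pdivlMl.
  rewrite !lebesgue_measure_itv/= !lte_fin ltr_pM2l ?invr_gt0//.
  case: ifPn => _; rewrite ?mule0//.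
  by rewrite -!EFinB -EFinM mulrBr !mulrA divff ?gt_eqF// !mul1r.
rewrite [in RHS](eq_measure_integral _ (fun A mA _ => lebE mt A mA)).
rewrite ge0_integral_mscale//= ge0_integral_pushforward//.
by rewrite muleA -EFinM mulVf ?gt_eqF// mul1e.
Qed.

Lemma integral_lebesgue_rVS d (f : 'rV[R]_d.+1 -> \bar R) :
  measurable_fun setT f -> (forall x, 0 <= f x) ->
  \int[lebesgue_rV d.+1]_x f x =
  \int[lebesgue_measure]_s \int[lebesgue_rV d]_v f (rV_cons (s, v)).
Proof.
move=> mf f0; rewrite /= /lebesgue_rV_step ge0_integral_pushforward//; last first.
  exact: measurable_rV_cons.
rewrite preimage_setT fubini_tonelli1//.
  by apply: measurableT_comp => //; exact: measurable_rV_cons.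
by move=> x; exact: f0.
Qed.

Lemma measurable_integral_rV_cons d (f : 'rV[R]_d.+1 -> \bar R) :
  measurable_fun setT f -> (forall x, 0 <= f x) ->
  measurable_fun setT (fun s : R => \int[lebesgue_rV d]_v f (rV_cons (s, v))).
Proof.
move=> mf f0.
have mg : measurable_fun setT (f \o @rV_cons R d).
  by apply: measurableT_comp => //; exact: measurable_rV_cons.
apply: (measurable_fun_fubini_tonelli_F (m2 := lebesgue_rV d) _ mg).
by move=> x; exact: f0.
Qed.

Lemma measurable_rV_cons_tail d (s : R) :
  measurable_fun setT (fun v : 'rV[R]_d => rV_cons (s, v)).
Proof.
apply: (measurableT_comp (@measurable_rV_cons R d)).
exact: pair1_measurable.
Qed.

Lemma measurable_scaler_rV d (t : R) :
  measurable_fun setT (fun x : 'rV[R]_d => t *: x)%R.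
Proof.
apply: measurable_fun_rV => i.
apply: (eq_measurable_fun (fun x : 'rV[R]_d => t * x ord0 i)%R).
  by move=> x _; rewrite mxE.
by apply: measurable_funM => //; exact: measurable_coord_rV.
Qed.

Lemma rV_consZ d (t s : R) (v : 'rV[R]_d) :
  (t *: rV_cons (s, v) = rV_cons (t * s, t *: v))%R.
Proof.
apply: etrans (@scale_row_mx _ 1 1 d t _ _) _; congr row_mx.
by apply/rowP => i; rewrite !mxE.
Qed.

(** Induction on the dimension: by Tonelli, each coordinate contributes one
    factor of the one-dimensional dilation formula. *)
Lemma integral_lebesgue_rV_dilation d (t : R) (f : 'rV[R]_d -> \bar R) :
  (0 < t)%R -> measurable_fun setT f -> (forall x, 0 <= f x) ->
  \int[lebesgue_rV d]_x f (t *: x)%R =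
  (t ^- d)%:E * \int[lebesgue_rV d]_x f x.
Proof.
move=> t0; elim: d f => [f mf f0|d IH f mf f0].
  rewrite expr0 invr1 mul1e; apply: eq_integral => x _.
  by congr f; apply/rowP => -[].
have mft : measurable_fun setT (fun x : 'rV[R]_d.+1 => f (t *: x)%R).
  by apply: measurableT_comp => //; exact: measurable_scaler_rV.
rewrite !integral_lebesgue_rVS//.
pose F s := \int[lebesgue_rV d]_v f (rV_cons (s, v)).
have mF : measurable_fun setT F by exact: measurable_integral_rV_cons.
have F0 s : 0 <= F s by exact: integral_ge0.
transitivity (\int[lebesgue_measure]_s ((t ^- d)%:E * F (t * s)%R)).
  apply: eq_integral => s _; rewrite /F -IH; last 2 first.
  - exact: (measurableT_comp mf (measurable_rV_cons_tail _)).
  - by move=> v; exact: f0.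
  by apply: eq_integral => v _; rewrite rV_consZ.
have mFt : measurable_fun setT (fun s : measurableTypeR R => F (t * s)%R).
  by apply: (measurableT_comp mF); exact: mulrl_measurable.
have td : 0 <= (t ^- d)%:E by rewrite lee_fin invr_ge0 exprn_ge0// ltW.
rewrite (ge0_integralZl _ measurableT mFt) => [|s _|]; [|exact: F0|exact: td].
rewrite (lebesgue_measure_dilation t0 mF F0) muleA -EFinM.
by rewrite exprSr invfM mulrC.
Qed.

Definition rV_box d (a b : R) : set 'rV[R]_d :=
  [set x | forall i, (a <= x ord0 i < b)%R].

Lemma measurable_rV_box d (a b : R) : measurable (@rV_box d a b).
Proof.
rewrite (_ : @rV_box d a b = \bigcap_(i in [set: 'I_d])
    ((fun x : 'rV[R]_d => x ord0 i) @^-1` `[a, b[%classic)).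
  apply: fin_bigcap_measurable => // i _; rewrite -[X in measurable X]setTI.
  exact: measurable_coord_rV.
apply/seteqP; split=> [x h i _|x h i]; first by rewrite /= in_itv/= h.
by have := h i I; rewrite /= in_itv.
Qed.

Lemma lebesgue_rV_box d (a b : R) : (a <= b)%R ->
  lebesgue_rV d (@rV_box d a b) = ((b - a) ^+ d)%:E.
Proof.
move=> ab; elim: d => [|d IH].
  by rewrite expr0 /= diracE mem_set// => -[].
rewrite /= /lebesgue_rV_step /pushforward.
have -> : @rV_cons R d @^-1` rV_box a b = `[a, b[%classic `*` @rV_box d a b.
  apply/seteqP; split=> [[s v]/= h|[s v]/= [hs hv] i].
    split; first by have := h ord0; rewrite rV_consE0 /= in_itv.
    by move=> i; have := h (rshift 1 i : 'I_d.+1); rewrite rV_consES.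
  move: hs; rewrite /= in_itv/= => hs.
  case: (@splitP 1 d i) => j ij.
    suff -> : i = ord0 by rewrite rV_consE0.
    by apply/val_inj; rewrite /= ij ord1.
  suff -> : i = (rshift 1 j : 'I_d.+1) by rewrite rV_consES; exact: hv.
  by apply/val_inj; rewrite /= ij.
rewrite product_measure1E//; last exact: measurable_rV_box.
have itvE : lebesgue_measure (`[a, b[%classic : set R) = (b - a)%:E.
  rewrite lebesgue_measure_itv/= lte_fin; case: ltP => [_|ba]; first by rewrite EFinB.
  by rewrite (@le_anti _ _ a b) ?ab// subrr.
by apply: etrans (congr2 mule itvE IH) _; rewrite -EFinM -exprS.
Qed.

End dilation.

(** * Integration against a measure with a density *)

Section density.
Context d (T : measurableType d) (R : realType).
Variables (nu mu : {measure set T -> \bar R}) (g : T -> R).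
Hypotheses (mg : measurable_fun setT g) (g0 : forall x, 0 <= g x).
Hypothesis nuE : forall B, measurable B -> nu B = (\int[mu]_(x in B) (g x)%:E)%E.
Local Open Scope ereal_scope.
Import HBNNSimple.

Let integral_density_indic (B D : set T) : measurable B -> measurable D ->
  \int[nu]_(x in D) (\1_B x)%:E = \int[mu]_(x in D) (\1_B x * g x)%:E.
Proof.
move=> mB mD; rewrite integral_indic// nuE; last exact: measurableI.
rewrite setIC integral_mkcondr; apply: eq_integral => x _.
rewrite patchE indicE; case: ifPn => xB; first by rewrite mul1r.
by rewrite mul0r.
Qed.

Let integral_density_nnsfun (h : {nnsfun T >-> R}) (D : set T) : measurable D ->
  \int[nu]_(x in D) (h x)%:E = \int[mu]_(x in D) (h x * g x)%:E.
Proof.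
move=> mD.
have mi y : measurable_fun D (fun x => (y * \1_(h @^-1` [set y]) x)%:E).
  apply/measurable_EFinP/measurable_funTS/measurable_funM => //.
transitivity (\sum_(y \in range h)
    \int[nu]_(x in D) (y * \1_(h @^-1` [set y]) x)%:E).
  rewrite -ge0_integral_fsum//; last by move=> y x _; exact: nnfun_muleindic_ge0.
  by apply: eq_integral => x _; rewrite fsumEFin// -fimfunE.
transitivity (\sum_(y \in range h)
    \int[mu]_(x in D) (y * \1_(h @^-1` [set y]) x * g x)%:E); last first.
  rewrite -ge0_integral_fsum//.
  - apply: eq_integral => x _; rewrite [in RHS](fimfunE h x) EFinM -fsumEFin//.
    under eq_fsbigr do rewrite EFinM.
    by rewrite ge0_mule_fsuml// => y; exact: nnfun_muleindic_ge0.
  - move=> y; apply/measurable_EFinP/measurable_funTS/measurable_funM => //.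
    exact: measurable_funM.
  - move=> y x _; rewrite EFinM; apply: mule_ge0; last by rewrite lee_fin.
    exact: nnfun_muleindic_ge0.
apply: eq_fsbigr => y; rewrite inE => -[x0 _ <-].
under eq_integral do rewrite EFinM.
under [RHS]eq_integral do rewrite -mulrA EFinM.
have h0 : 0 <= (h x0)%:E by rewrite lee_fin.
rewrite !ge0_integralZl//.
- by congr (_ * _); exact: integral_density_indic.
- apply/measurable_EFinP/measurable_funTS/measurable_funM => //.
- by move=> x _; rewrite lee_fin mulr_ge0.
- by apply/measurable_EFinP/measurable_funTS.
Qed.

(** From indicators to simple functions by linearity, then to nonnegative
    functions by monotone convergence. *)
Lemma ge0_integral_density (f : T -> R) (D : set T) : measurable D ->
  measurable_fun setT f -> (forall x, (0 <= f x)%R) ->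
  \int[nu]_(x in D) (f x)%:E = \int[mu]_(x in D) (f x * g x)%:E.
Proof.
move=> mD mf f0.
have mfD : measurable_fun D (EFin \o f) by exact/measurable_EFinP/measurable_funTS.
pose h := nnsfun_approx mD mfD.
have hcvg x : D x -> (h n x)%:E @[n --> \oo] --> (f x)%:E.
  by move=> Dx; apply: cvg_nnsfun_approx => // y _; rewrite lee_fin.
have hnd x : D x -> {homo (fun n => h n x) : m n / (m <= n)%N >-> (m <= n)%R}.
  by move=> Dx m n mn; exact/lefP/nd_nnsfun_approx.
transitivity (limn (fun n => \int[nu]_(x in D) (h n x)%:E)).
  rewrite -monotone_convergence//.
  - by apply: eq_integral => x /[!inE] xD; apply/esym/cvg_lim => //; exact: hcvg.
  - by move=> n; exact/measurable_EFinP/measurable_funTS.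
  - by move=> n x _; rewrite lee_fin.
under eq_fun do rewrite integral_density_nnsfun//.
rewrite -monotone_convergence//.
- apply: eq_integral => x /[!inE] xD; apply/cvg_lim => //.
  under eq_fun do rewrite EFinM.
  by rewrite EFinM; apply: cvgeZr => //; exact: hcvg.
- by move=> n; apply/measurable_EFinP/measurable_funTS/measurable_funM.
- by move=> n x _; rewrite lee_fin mulr_ge0.
- by move=> x Dx m n mn; rewrite lee_fin ler_wpM2r//; exact: hnd.
Qed.

End density.

(** * Directional derivatives from continuous partial derivatives *)

Section directional_derivative.
Context {R : realType} {d : nat}.
Implicit Types (u : 'rV[R]_d -> R) (x v : 'rV[R]_d).

(** The two difference quotients are the same function of the increment, so
    calculus along a line reduces to calculus on [R]. *)
Lemma is_derive_along u x v df : is_derive x v u df <->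
  is_derive (0 : R) 1 (fun s : R => u (s *: v + x)) df.
Proof.
have E : (fun h : R => h^-1 *: ((fun s : R => u (s *: v + x)) (h *: 1 + 0)
      - (fun s : R => u (s *: v + x)) 0)) =
    (fun h : R => h^-1 *: (u (h *: v + x) - u x)).
  by apply/funext => h; rewrite addr0 scale0r add0r /GRing.scale/= mulr1.
split=> -[du <-]; constructor.
- by rewrite /derivable; move: du; rewrite /derivable -E.
- by rewrite /derive -E.
- by rewrite /derivable; move: du; rewrite /derivable -E.
- by rewrite /derive -E.
Qed.

Lemma is_derive_shift u x v (s : R) df : is_derive (s *: v + x) v u df ->
  is_derive s 1 (fun s : R => u (s *: v + x)) df.
Proof.
have E : (fun h : R => h^-1 *: ((fun s : R => u (s *: v + x)) (h *: 1 + s)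
      - (fun s : R => u (s *: v + x)) s)) =
    (fun h : R => h^-1 *: (u (h *: v + (s *: v + x)) - u (s *: v + x))).
  by apply/funext => h; rewrite /GRing.scale/= mulr1 addrA -scalerDl.
move=> [du <-]; constructor.
- by rewrite /derivable; move: du; rewrite /derivable -E.
- by rewrite /derive -E.
Qed.

Lemma MVT_along u v x (t : R) (df : 'rV[R]_d -> R) :
  (forall y, is_derive y v u (df y)) ->
  exists2 s, `|s| <= `|t| & u (t *: v + x) - u x = t * df (s *: v + x).
Proof.
move=> du; pose f (s : R) := u (s *: v + x).
have df1 (s : R) : is_derive s 1 f (df (s *: v + x)) by exact: is_derive_shift.
have cf (a b : R) : {within `[a, b], continuous f}.
  apply: continuous_subspaceT => s; apply: differentiable_continuous.
  by apply/derivable1_diffP; case: (df1 s).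
have ux : u x = f 0 by rewrite /f scale0r add0r.
rewrite ux -/(f t); have [t0|t0] := leP 0 t.
  have [s] := MVT_segment t0 (fun s _ => df1 s) (cf 0 t).
  rewrite in_itv/= => /andP[s0 st] ->; exists s; last by rewrite subr0 mulrC.
  by rewrite !ger0_norm.
have [s] := MVT_segment (ltW t0) (fun s _ => df1 s) (cf t 0).
rewrite in_itv/= => /andP[ts s0] E; exists s.
  by rewrite !ler0_norm ?lerN2// ltW.
by rewrite -opprB E sub0r mulrN opprK mulrC.
Qed.

(** Moving from [x] to [x + t v] one coordinate at a time, the mean value theorem
    writes the increment as a sum of partial derivatives at intermediate points;
    these points tend to [x] with [t], and continuity of the partial derivatives
    gives the limit. *)
Lemma is_derive_continuous_partial u x v :
  (forall i y, derivable u y (delta_mx ord0 i)) ->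
  (forall i, continuous (partial i u)) ->
  is_derive x v u (\sum_i v ord0 i * partial i u x).
Proof.
move=> du cu.
suff : (fun h : R => h^-1 *: (u (h *: v + x) - u x)) @ 0^' -->
    \sum_i v ord0 i * partial i u x.
  move=> h; constructor; first by apply/cvg_ex; eexists; exact: h.
  by apply/cvg_lim.
apply/cvgrPdist_le => e e0.
pose V := \sum_i `|v ord0 i| + 1.
have V0 : 0 < V by rewrite ltr_wpDl// sumr_ge0.
have eV : 0 < e / V by rewrite divr_gt0.
have : \forall y \near x, forall i, `|partial i u x - partial i u y| <= e / V.
  have := @filter_forall _ _ (fun i y => `|partial i u x - partial i u y| <= e / V) (nbhs x) _.
  apply => i.
  by move/cvgrPdist_le : (cu i x); exact.
move=> /nbhs_ballP[r /= r0 xr].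
near=> t.
have t0 : t != 0 by near: t; exact: nbhs_dnbhs_neq.
have tV : `|t| * V < r.
  by rewrite -ltr_pdivlMr//; near: t; apply: dnbhs0_lt; exact: divr_gt0.
(* [w k] has the first [k] coordinates of the endpoint and the others of [x] *)
pose w (k : nat) : 'rV[R]_d :=
  \row_j (if (j < k)%N then t * v ord0 j + x ord0 j else x ord0 j).
have w0 : w 0%N = x by apply/rowP => j; rewrite mxE.
have wd : w d = t *: v + x by apply/rowP => j; rewrite !mxE ltn_ord.
have step (k : 'I_d) : exists2 z, ball x r z &
    u (w k.+1) - u (w k) = t * v ord0 k * partial k u z.
  have [s st E] := @MVT_along u (delta_mx ord0 k) (w k) (t * v ord0 k)
    (partial k u) (fun y => DeriveDef (du k y) erefl).
  exists (s *: delta_mx ord0 k + w k); last first.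
    rewrite -E; congr (u _ - _); apply/rowP => j; rewrite !mxE eqxx/=.
    rewrite ltnS leq_eqVlt; have [->|jk] := eqVneq j k.
      by rewrite eqxx ltnn mulr1.
    by rewrite (inj_eq val_inj) (negPf jk) mulr0 add0r.
  split=> // i j; rewrite ord1 /ball/= !mxE eqxx/=.
  have tvV l : `|t * v ord0 l| < r.
    apply: le_lt_trans tV; rewrite normrM ler_wpM2l// /V.
    by rewrite (bigD1 l)//= -addrA lerDl addr_ge0// sumr_ge0.
  have [->|jk] := eqVneq j k.
    by rewrite ltnn mulr1 opprD addrCA subrr addr0 normrN (le_lt_trans st).
  rewrite mulr0 add0r; case: ifPn => _; last by rewrite subrr normr0.
  by rewrite opprD addrCA subrr addr0 normrN.
have -> : t^-1 *: (u (t *: v + x) - u x) =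
    \sum_(k < d) t^-1 * (u (w k.+1) - u (w k)).
  rewrite -mulr_sumr -(big_mkord xpredT (fun k => u (w k.+1) - u (w k))).
  by rewrite telescope_sumr// wd w0.
rewrite -sumrB (le_trans (ler_norm_sum _ _ _))//.
apply: (@le_trans _ _ (\sum_i `|v ord0 i| * (e / V))).
  apply: ler_sum => k _; have [z xz ->] := step k.
  by rewrite -mulrA mulKf// -mulrBr normrM ler_wpM2l// xr.
rewrite -mulr_suml mulrCA ger_pMr// ler_pdivrMr// mul1r.
by rewrite /V lerDl.
Unshelve. all: by end_near. Qed.

End directional_derivative.

(** * Euclidean norm, quadratic forms and real powers *)

Section euclidean_norm.
Context {R : realType} {d : nat}.
Implicit Types (x y : 'rV[R]_d) (A : 'M[R]_d).

Lemma enorm_ge0 x : 0 <= enorm x. Proof. exact: sqrtr_ge0. Qed.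

Lemma sqr_enorm x : enorm x ^+ 2 = \sum_i x ord0 i ^+ 2.
Proof. by rewrite sqr_sqrtr// sumr_ge0// => i _; rewrite sqr_ge0. Qed.

Lemma coord_le_enorm x i : `|x ord0 i| <= enorm x.
Proof.
rewrite -(@ler_pXn2r _ 2%N) ?nnegrE ?enorm_ge0// sqr_enorm real_normK ?num_real//.
by rewrite (bigD1 i)//= lerDl sumr_ge0// => j _; rewrite sqr_ge0.
Qed.

Lemma enorm0_eq0 x : enorm x = 0 -> x = 0.
Proof.
move=> x0; apply/rowP => i; rewrite mxE; apply/eqP; rewrite -normr_le0.
by rewrite -x0 coord_le_enorm.
Qed.

Lemma enorm_gt0 (x : 'rV[R]_d) : x != 0 -> 0 < enorm x.
Proof.
by move=> xn0; rewrite lt_def enorm_ge0 andbT; apply: contra_neq xn0; exact: enorm0_eq0.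
Qed.

Lemma enormZ (t : R) x : 0 <= t -> enorm (t *: x) = t * enorm x.
Proof.
move=> t0; apply/eqP; rewrite -(@eqrXn2 _ 2%N) ?enorm_ge0 ?mulr_ge0 ?enorm_ge0//.
rewrite exprMn !sqr_enorm mulr_sumr; apply/eqP/eq_bigr => i _.
by rewrite mxE exprMn.
Qed.

Lemma enorm_le_sum x : enorm x <= \sum_i `|x ord0 i|.
Proof.
rewrite -(@ler_pXn2r _ 2%N) ?nnegrE ?enorm_ge0 ?sumr_ge0// sqr_enorm.
rewrite [leRHS]expr2 mulr_suml; apply: ler_sum => i _.
rewrite -real_normK ?num_real// expr2 ler_wpM2l//.
by rewrite (bigD1 i)//= lerDl sumr_ge0.
Qed.

(** Cauchy-Schwarz, from Lagrange's identity. *)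
Lemma inner_le_enorm x y :
  `|\sum_i x ord0 i * y ord0 i| <= enorm x * enorm y.
Proof.
rewrite -(@ler_pXn2r _ 2%N) ?nnegrE ?mulr_ge0 ?enorm_ge0//.
rewrite real_normK ?num_real// exprMn !sqr_enorm -subr_ge0.
rewrite -(@pmulr_rge0 _ 2)//.
suff -> : 2 * ((\sum_i x ord0 i ^+ 2) * (\sum_i y ord0 i ^+ 2)
     - (\sum_i x ord0 i * y ord0 i) ^+ 2) =
   \sum_i \sum_j (x ord0 i * y ord0 j - x ord0 j * y ord0 i) ^+ 2.
  by apply: sumr_ge0 => i _; apply: sumr_ge0 => j _; exact: sqr_ge0.
set X := \sum_i x ord0 i ^+ 2; set Y := \sum_i y ord0 i ^+ 2.
set Z := \sum_i _ * _.
transitivity (\sum_i (x ord0 i ^+ 2 * Y + X * y ord0 i ^+ 2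
    - 2 * (x ord0 i * y ord0 i) * Z)).
  rewrite sumrB big_split/= -mulr_suml -mulr_sumr -mulr_suml -mulr_sumr.
  by rewrite -/X -/Y -/Z; ring.
apply: eq_bigr => i _; rewrite /X /Y /Z mulr_sumr mulr_suml mulr_sumr.
rewrite -big_split -sumrB/=; apply: eq_bigr => j _; ring.
Qed.

Lemma quadZ A (t : R) x : quad A (t *: x) = t ^+ 2 * quad A x.
Proof.
by rewrite /quad linearZ/= -scalemxAl -scalemxAl -scalemxAr scalerA mxE expr2.
Qed.

Lemma quad_le_enorm A x :
  `|quad A x| <= (\sum_i \sum_j `|A j i|) * enorm x ^+ 2.
Proof.
rewrite /quad mxE mulr_suml (le_trans (ler_norm_sum _ _ _))//.
apply: ler_sum => i _; rewrite !mxE mulr_suml mulr_suml.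
rewrite (le_trans (ler_norm_sum _ _ _))//; apply: ler_sum => j _.
rewrite !normrM [X in X * _ <= _]mulrC -mulrA; apply: ler_wpM2l => //.
by rewrite expr2 ler_pM// coord_le_enorm.
Qed.

Lemma measurable_enorm : measurable_fun setT (@enorm R d).
Proof.
apply: (measurableT_comp (continuous_measurable_fun (@sqrt_continuous R))).
by apply: measurable_sum => i; apply: measurable_funX; exact: measurable_coord_rV.
Qed.

Lemma measurable_enorm_powR (r : R) :
  measurable_fun setT (fun x : 'rV[R]_d => enorm x `^ r).
Proof. by apply: (measurableT_comp (measurable_powR _)); exact: measurable_enorm. Qed.

End euclidean_norm.

Section powR_facts.
Context {R : realType}.

(** One of the two endpoints bounds a power on an interval; the sum avoids
    distinguishing the sign of the exponent. *)
Lemma powR_le_sum (r r0 r1 y : R) : 0 < r0 -> r0 <= r <= r1 ->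
  r `^ y <= r0 `^ y + r1 `^ y.
Proof.
move=> r00 /andP[r0r rr1]; have r0' : 0 < r := lt_le_trans r00 r0r.
have r10 : 0 < r1 := lt_le_trans r0' rr1.
have [y0|y0] := leP 0 y.
  by rewrite ler_wpDl ?powR_ge0// ge0_ler_powR// nnegrE ltW.
rewrite ler_wpDr ?powR_ge0// -(opprK y) !(powRN _ (- y)) lef_pV2 ?posrE ?powR_gt0//.
by apply: ge0_ler_powR; rewrite ?nnegrE ?oppr_ge0// ltW.
Qed.

(** Away from [0] this is the derivative of a power; at [0] the difference
    quotient is at most [|h|] to the power [p - 1 > 0]. This is where [1 < p]
    makes [|u|] to the power [p] differentiable across the zeros of [u]. *)
Lemma is_derive_norm_powR (p t : R) : 1 < p ->
  is_derive t 1 (fun s : R => `|s| `^ p) (p * Num.sg t * `|t| `^ (p - 1)).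
Proof.
move=> p1; have p0 : 0 < p by lra.
have [t0|t0|->] := ltgtP t 0.
- have D : is_derive t 1 ((@powR R ^~ p) \o (-%R)) (p * (- t) `^ (p - 1) * (-1)).
    by apply: is_derive1_comp; apply: is_derive1_powR; rewrite oppr_gt0.
  rewrite ltr0_sg// ltr0_norm// mulrN1 mulNr -mulrN1.
  apply: near_eq_is_derive D; near=> s => /=; rewrite ltr0_norm//.
  by near: s; exact: lt_nbhsl.
- have D : is_derive t 1 (@powR R ^~ p) (p * t `^ (p - 1)).
    exact: is_derive1_powR.
  rewrite gtr0_sg// gtr0_norm// mulr1.
  apply: near_eq_is_derive D; near=> s => /=; rewrite gtr0_norm//.
  by near: s; exact: lt_nbhsr.
- rewrite sgr0 mulr0 mul0r.
  suff : (fun h : R => h^-1 *: (`|(h *: (1 : R) + 0 : R)| `^ p - `|0 : R| `^ p)) @ 0^' --> (0:R).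
    move=> h; constructor; first by apply/cvg_ex; eexists; exact: h.
    by apply/cvg_lim.
  apply/cvgrPdist_le => e e0.
  near=> h.
  have h0 : h != 0 by near: h; exact: nbhs_dnbhs_neq.
  rewrite normr0 powR0 ?gt_eqF// subr0 addr0 sub0r normrN /GRing.scale/= mulr1.
  have nh : 0 < `|h| by rewrite normr_gt0.
  rewrite normrM normfV ger0_norm ?powR_ge0// -[X in X * _]powR_inv1//.
  rewrite -powRD; last by apply/implyP => _; rewrite gt_eqF.
  have he : `|h| <= e `^ (p - 1)^-1.
    by apply: ltW; near: h; apply: dnbhs0_lt; rewrite powR_gt0.
  apply: (@le_trans _ _ ((e `^ (p - 1)^-1) `^ (p - 1))).
    rewrite addrC ge0_ler_powR ?nnegrE ?powR_ge0//; lra.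
  have pn : p - 1 != 0 by rewrite gt_eqF// subr_gt0.
  by rewrite -powRrM mulVf// powRr1// ltW.
Unshelve. all: by end_near. Qed.

End powR_facts.

(** * Test functions and their supports *)

Section support.
Context {R : realType} {d : nat}.
Variable u : 'rV[R]_d -> R.
Hypothesis smooth_u : smooth u.
Local Notation K := (closure [set x | u x != 0]).

Lemma smooth_continuous : continuous u.
Proof. by have [] := smooth_u [::]. Qed.

Lemma smooth_partial_continuous i : continuous (partial i u).
Proof. by have [] := smooth_u [:: i]. Qed.

Lemma smooth_is_derive x v :
  is_derive x v u (\sum_i v ord0 i * partial i u x).
Proof.
apply: is_derive_continuous_partial => [i y|]; last exact: smooth_partial_continuous.
by have [_] := smooth_u [::]; exact.
Qed.

(** The complement of the support is open, so the function is locally zero there. *)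
Lemma off_support x : ~ K x -> u x = 0 /\ forall i, partial i u x = 0.
Proof.
move=> Kx; have cKx : (~` K) x by [].
have oK : open (~` K) by apply: closed_openC; exact: closed_closure.
have near0 : \forall y \near x, cst 0 y = u y.
  have : nbhs x (~` K) by exact: open_nbhs_nbhs.
  apply: filterS => y Ky /=; apply/esym/eqP; apply: contra_notT Ky => uy.
  exact: subset_closure.
split; first by have := nbhs_singleton near0.
by move=> i; rewrite /partial -(near_eq_derive _ near0) derive_cst.
Qed.

Lemma continuous_bounded_on_support (f : 'rV[R]_d -> R) :
  compact K -> continuous f -> exists2 M, 0 <= M & forall x, K x -> `|f x| <= M.
Proof.
move=> cK cf.
have /compact_bounded [M [_ Mb]] : compact (f @` K).
  by apply: continuous_compact => //; exact: continuous_subspaceT.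
exists (`|M| + 1); first by rewrite addr_ge0.
move=> x Kx; apply: (Mb (`|M| + 1)); last by exists x.
by rewrite (le_lt_trans (ler_norm _))// ltrDl.
Qed.

(** Compactness bounds the support from outside and, as [0] is not in the closed
    support, a ball around [0] avoids it: the singular weight is harmless. *)
Lemma support_enorm_bounds : compact K -> ~ K 0 ->
  exists r0 r1, [/\ 0 < r0, 0 < r1 & forall x, K x -> r0 <= enorm x <= r1].
Proof.
move=> cK K0; have : nbhs (0 : 'rV[R]_d) (~` K).
  apply: open_nbhs_nbhs; split => //.
  by apply: closed_openC; exact: closed_closure.
move=> /nbhs_ballP[r0 /= r00 r0K].
have [M [_ Mb]] := compact_bounded cK.
pose B := `|M| + 1.
have KB x : K x -> `|x| <= B.
  by move=> Kx; apply: Mb => //; rewrite (le_lt_trans (ler_norm _))// ltrDl.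
exists r0, (d%:R * B + 1); split => //.
  by rewrite ltr_wpDl// mulr_ge0// addr_ge0.
move=> x Kx; apply/andP; split.
  rewrite leNgt; apply/negP => xr0; apply: (r0K x) Kx.
  split => // i j; rewrite ord1 /ball/= mxE sub0r normrN.
  exact: le_lt_trans (coord_le_enorm _ _) xr0.
rewrite (le_trans (enorm_le_sum _))// ler_wpDr//.
apply: (@le_trans _ _ (\sum_(i < d) B)); last first.
  by rewrite sumr_const card_ord mulr_natl.
apply: ler_sum => i _; apply: le_trans (KB _ Kx).
rewrite [leRHS]/Num.norm/= mx_normrE; apply/bigmax_geP; right => /=.
by exists (ord0, i).
Qed.

End support.

Section integrable.
Context {R : realType} {d : nat}.

Lemma bounded_integrable_rV (f : 'rV[R]_d -> R) (B M : R) :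
  measurable_fun setT f -> 0 <= B -> 
  (forall x, `|f x| <= M) -> (forall x, B < enorm x -> f x = 0) ->
  (lebesgue_rV d).-integrable setT (EFin \o f).
Proof.
move=> mf B0 fM fB.
pose E : set 'rV[R]_d := rV_box (- (B + 1)) (B + 1).
have mE : measurable E by exact: measurable_rV_box.
have fE : f = f \_ E.
  apply/funext => x; rewrite patchE; case: ifPn => // /negP xE.
  rewrite fB// ltNge; apply/negP => xB; apply: xE; rewrite inE => i.
  have := le_trans (coord_le_enorm x i) xB; rewrite ler_norml => /andP[h1 h2].
  by apply/andP; split; lra.
have -> : EFin \o f = (EFin \o f) \_ E.
  by rewrite [in LHS]fE restrict_EFin.
apply/(integrable_mkcond _ mE); apply: measurable_bounded_integrable => //.
- rewrite [ltLHS](_ : _ = ((B + 1 - (- (B + 1))) ^+ d)%:E) ?ltry//.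
  by apply: lebesgue_rV_box; lra.
- exact: measurable_funTS.
- exists M; split; first exact: num_real.
  by move=> N MN x _; apply: le_trans (fM x) (ltW MN).
Qed.

End integrable.

(** * The radial vector field and its divergence *)

Section radial_identity.
Context {R : realType} (d : nat).
Variables (p c beta : R) (A : 'M[R]_d) (u : 'rV[R]_d -> R).
Hypotheses (p1 : 1 < p) (A0 : forall x, 0 <= quad A x).
Hypotheses (smooth_u : smooth u).

Definition weight (x : 'rV[R]_d) : R := enorm x `^ (- (p + beta)) * rho p c A x.

Definition radial_derivative (x : 'rV[R]_d) : R :=
  \sum_i x ord0 i * partial i u x.

Definition weighted_power (x : 'rV[R]_d) : R := `|u x| `^ p * weight x.

(** The divergence of the vector field mapping [x] to [weighted_power x *: x], that
    is [d F + x . grad F], written out; the term in [quad] comes from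
    the gradient of the density [rho]. *)
Definition radial_divergence (x : 'rV[R]_d) : R :=
  (p * Num.sg (u x) * `|u x| `^ (p - 1) * radial_derivative x
   + (d%:R - (p + beta) - quad A x `^ (p / 2)) * `|u x| `^ p) * weight x.

Local Notation F := weighted_power.
Local Notation H := radial_divergence.

Lemma quad_powR_dilation (s : R) x : 0 <= s ->
  quad A (s *: x) `^ (p / 2) = s `^ p * quad A x `^ (p / 2).
Proof.
move=> s0; rewrite quadZ powRM ?sqr_ge0// -[s ^+ 2]powR_mulrn// -powRrM.
by congr (_ `^ _ * _); field.
Qed.

Lemma weight_dilation (s : R) x : 0 < s ->
  weight (s *: x) = s `^ (- (p + beta)) * enorm x `^ (- (p + beta)) *
    (c * expR (- (p^-1 * (s `^ p * quad A x `^ (p / 2))))).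
Proof.
move=> s0; rewrite /weight /rho quad_powR_dilation ?ltW//.
by rewrite enormZ ?ltW// powRM ?enorm_ge0// ltW.
Qed.

(** Along a ray the norm and the quadratic form are powers of the parameter, so
    only [u] needs to be differentiated in the direction [x]. *)
Lemma is_derive_weighted_power_ray x :
  is_derive (1 : R) 1 (fun s : R => s ^+ d * F (s *: x)) (H x).
Proof.
set q := quad A x `^ (p / 2).
have pn0 : p != 0 by rewrite gt_eqF// (lt_trans _ p1).
have Du : is_derive (1 : R) 1 (fun s : R => u (s *: x)) (radial_derivative x).
  have := @is_derive_shift R d u 0 x 1 (radial_derivative x).
  rewrite addr0 scale1r => /(_ (smooth_is_derive smooth_u x x)).
  by congr is_derive; apply/funext => s; rewrite addr0.
have D1 : is_derive (1 : R) 1 (fun s : R => `|u (s *: x)| `^ p)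
    (p * Num.sg (u x) * `|u x| `^ (p - 1) * radial_derivative x).
  have := @is_derive1_comp R (fun t => `|t| `^ p) (fun s : R => u (s *: x)) 1
    (p * Num.sg (u x) * `|u x| `^ (p - 1)) (radial_derivative x).
  by apply => //=; rewrite scale1r; exact: is_derive_norm_powR.
have D2 : is_derive (1 : R) 1 (@powR R ^~ (- (p + beta))) (- (p + beta)).
  have := @is_derive1_powR R (- (p + beta)) 1 ltr01.
  by rewrite powR1 mulr1.
have D3 : is_derive (1 : R) 1 (expR \o (fun s : R => - (p^-1 * q) * s `^ p))
    (expR (- (p^-1 * q)) * (- q)).
  have D : is_derive (1 : R) 1 (fun s : R => - (p^-1 * q) * s `^ p) (- q).
    have := is_deriveZ (- (p^-1 * q)) (@is_derive1_powR R p 1 ltr01).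
    by rewrite powR1 mulr1 /GRing.scale/= mulNr [p^-1 * q]mulrC mulfVK.
  have := is_derive1_comp (is_derive_expR _) D.
  by rewrite powR1 mulr1.
pose G (s : R) : R := s ^+ d * (`|u (s *: x)| `^ p *
  (s `^ (- (p + beta)) * (expR \o (fun s : R => - (p^-1 * q) * s `^ p)) s)) *
  (enorm x `^ (- (p + beta)) * c).
apply: (@near_eq_is_derive _ _ _ G).
  near=> s; rewrite /G /F weight_dilation//=; last by near: s; exact: lt_nbhsr.
  by rewrite -/q mulNr [s `^ p * q]mulrC [p^-1 * (q * _)]mulrA; ring.
have D0 : is_derive (1 : R) 1 (fun s : R => s ^+ d) d%:R.
  have := @is_deriveX R R id d 1 1 1 (is_derive_id _ _).
  by rewrite exprfctE expr1n mulr1 /GRing.scale/= mulr1.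
have := is_deriveM (is_deriveM D0 (is_deriveM D1 (is_deriveM D2 D3)))
  (is_derive_cst (enorm x `^ (- (p + beta)) * c : R) (1 : R) (1 : R)).
move=> D; apply: (is_derive_eq D).
rewrite !mulrfctE /cst/= !scale1r !powR1 expr1n !mulr1 /GRing.scale/=.
by rewrite /H /weight /rho -/q; ring.
Unshelve. all: by end_near. Qed.

End radial_identity.

Section radial_identity_integral.
Context {R : realType} (d : nat).
Variables (p c beta : R) (A : 'M[R]_d) (u : 'rV[R]_d -> R).
Hypotheses (p1 : 1 < p) (c0 : 0 < c) (A0 : forall x, 0 <= quad A x).
Hypotheses (smooth_u : smooth u).
Local Notation K := (closure [set x | u x != 0]).
Hypotheses (cK : compact K) (K0 : ~ K 0).
Local Notation weight := (weight p c beta A).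
Local Notation F := (weighted_power p c beta A u).
Local Notation H := (radial_divergence p c beta A u).

Let p0 : 0 < p. Proof. exact: lt_trans p1. Qed.
Let cu : continuous u. Proof. exact: smooth_continuous. Qed.
Let cdu i : continuous (partial i u). Proof. exact: smooth_partial_continuous. Qed.

(** The derivative at [s] follows from the one at [1] at the point [s *: x],
    because [r *: x = (r / s) *: (s *: x)]. *)
Lemma is_derive_weighted_power_at (s : R) x : 0 < s ->
  is_derive s 1 (fun r : R => r ^+ d * F (r *: x)) (s ^+ d * H (s *: x) / s).
Proof.
move=> s0; have sn0 : s != 0 by rewrite gt_eqF.
have D : is_derive (s / s) 1 (fun r : R => r ^+ d * F (r *: (s *: x))) (H (s *: x)).
  by rewrite divff//; exact: is_derive_weighted_power_ray.
have D1 : is_derive s 1 (fun r : R => r / s) s^-1.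
  have := is_deriveZ s^-1 (is_derive_id s (1 : R)).
  rewrite [s^-1 *: 1]mulr1; congr is_derive.
  by apply/funext => r; rewrite mulrC.
have := is_deriveZ (s ^+ d) 
  (@is_derive1_comp R (fun r : R => r ^+ d * F (r *: (s *: x)))
    (fun r : R => r / s) s _ _ D D1).
move=> E; rewrite (_ : (fun r : R => _) = s ^+ d \*:
    ((fun r : R => r ^+ d * F (r *: (s *: x))) \o (fun r : R => r / s))).
  by apply: (is_derive_eq E); rewrite /GRing.scale/= mulrA.
apply/funext => r /=; rewrite scalerA divfK//.
rewrite -[RHS]/(s ^+ d * ((r / s) ^+ d * F (r *: x))) [RHS]mulrA -exprMn.
by rewrite [s * _]mulrC divfK.
Qed.

Lemma weight_ge0 x : 0 <= weight x.
Proof. by rewrite mulr_ge0 ?powR_ge0// rho_ge0// ltW. Qed.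

Lemma measurable_weight : measurable_fun setT weight.
Proof.
apply: measurable_funM; last exact: measurable_rho.
by apply: (measurableT_comp (measurable_powR _)); exact: measurable_enorm.
Qed.

Lemma measurable_abs_powR (r : R) : measurable_fun setT (fun x => `|u x| `^ r).
Proof.
apply: (measurableT_comp (measurable_powR _)).
by apply: measurableT_comp => //; exact: continuous_measurable_rV cu.
Qed.

Lemma measurable_quad_powR (r : R) : measurable_fun setT (fun x => quad A x `^ r).
Proof. by apply: (measurableT_comp (measurable_powR _)); exact: measurable_quad. Qed.

Lemma measurable_weighted_power : measurable_fun setT F.
Proof. by apply: measurable_funM measurable_weight; exact: measurable_abs_powR. Qed.

Lemma measurable_radial_derivative : measurable_fun setT (radial_derivative u).
Proof.
apply: measurable_sum => i; apply: measurable_funM; first exact: measurable_coord_rV.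
exact: continuous_measurable_rV (@cdu i).
Qed.

Lemma measurable_sgr : measurable_fun setT (@Num.sg R).
Proof.
rewrite (_ : @Num.sg R = fun t => if 0 < t then 1 else if t < 0 then -1 else 0).
  apply: measurable_fun_ifT => //; first exact: measurable_fun_ltr.
  by apply: measurable_fun_ifT => //; exact: measurable_fun_ltr.
by apply/funext => t; case: sgrP.
Qed.

Lemma measurable_radial_divergence : measurable_fun setT H.
Proof.
apply: measurable_funM measurable_weight; apply: measurable_funD.
  apply: measurable_funM measurable_radial_derivative; apply: measurable_funM.
    apply: measurable_funM => //; apply: (measurableT_comp measurable_sgr).
    exact: continuous_measurable_rV cu.
  exact: measurable_abs_powR.
apply: measurable_funM; last exact: measurable_abs_powR.
by apply: measurable_funB => //; exact: measurable_quad_powR.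
Qed.

Lemma weighted_power_off x : ~ K x -> F x = 0.
Proof.
by move=> /off_support[ux _]; rewrite /weighted_power ux normr0 powR0 ?gt_eqF// mul0r.
Qed.

Lemma radial_divergence_off x : ~ K x -> H x = 0.
Proof.
move=> /off_support[ux dux]; rewrite /radial_divergence ux sgr0 normr0.
by rewrite (powR0 (lt0r_neq0 p0)) !mulr0 !mul0r addr0 mul0r.
Qed.

Lemma rho_le x : rho p c A x <= c.
Proof.
rewrite ger_pMr// -[leRHS]expR0 ler_expR oppr_le0 mulr_ge0 ?powR_ge0//.
by rewrite invr_ge0 ltW.
Qed.

Lemma weight_bounded : exists2 M, 0 <= M & forall x, K x -> weight x <= M.
Proof.
have [r0 [r1 [r00 r10 rK]]] := support_enorm_bounds cK K0.
exists ((r0 `^ (- (p + beta)) + r1 `^ (- (p + beta))) * c).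
  by rewrite mulr_ge0 ?ltW// addr_gt0// powR_gt0.
move=> x Kx; apply: ler_pM; [exact: powR_ge0|exact/rho_ge0/ltW| |].
  by apply: powR_le_sum => //; exact: rK.
exact: rho_le.
Qed.

Lemma quad_powR_bounded :
  exists2 M, 0 <= M & forall x, K x -> quad A x `^ (p / 2) <= M.
Proof.
have [r0 [r1 [r00 r10 rK]]] := support_enorm_bounds cK K0.
exists (((\sum_i \sum_j `|A j i|) * r1 ^+ 2) `^ (p / 2)); first exact: powR_ge0.
move=> x Kx; apply: ge0_ler_powR; rewrite ?nnegrE ?A0//.
- by rewrite divr_ge0 ?ltW.
- by rewrite mulr_ge0 ?sqr_ge0// sumr_ge0// => i _; rewrite sumr_ge0.
rewrite (le_trans (ler_norm _))// (le_trans (quad_le_enorm _ _))//.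
apply: ler_wpM2l; first by rewrite sumr_ge0// => i _; rewrite sumr_ge0.
by have /andP[_ h] := rK _ Kx; rewrite ler_pXn2r ?nnegrE ?enorm_ge0// ltW.
Qed.

Lemma abs_powR_bounded (r : R) : 0 <= r ->
  exists2 M, 0 <= M & forall x, K x -> `|u x| `^ r <= M.
Proof.
move=> r0; have [M M0 uM] := continuous_bounded_on_support cK cu.
exists (M `^ r); first exact: powR_ge0.
by move=> x Kx; rewrite ge0_ler_powR ?nnegrE// uM.
Qed.

Lemma grad_bounded :
  exists2 M, 0 <= M & forall x, K x -> enorm (grad u x) <= M.
Proof.
have /boolp.choice[M hM] : forall i, exists M, forall x, K x -> `|partial i u x| <= M.
  by move=> i; have [M _ h] := continuous_bounded_on_support cK (@cdu i); exists M.
exists (\sum_i `|M i|); first exact: sumr_ge0.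
move=> x Kx; rewrite (le_trans (enorm_le_sum _))// ler_sum// => i _.
by rewrite mxE (le_trans (hM _ _ Kx))// ler_norm.
Qed.

Lemma radial_derivative_le x :
  `|radial_derivative u x| <= enorm x * enorm (grad u x).
Proof.
rewrite (le_trans _ (inner_le_enorm _ _))// le_eqVlt; apply/orP; left.
by apply/eqP; congr `|_|; apply: eq_bigr => i _; rewrite mxE.
Qed.

Lemma weighted_power_bounded : exists2 M, 0 <= M & forall x, `|F x| <= M.
Proof.
have [W W0 hW] := weight_bounded.
have [U U0 hU] := abs_powR_bounded (ltW p0).
exists (U * W); first exact: mulr_ge0.
move=> x; have [Kx|/weighted_power_off->] := pselect (K x); last by rewrite normr0 mulr_ge0.
rewrite ger0_norm; last by rewrite mulr_ge0 ?powR_ge0 ?weight_ge0.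
by apply: ler_pM; rewrite ?powR_ge0 ?weight_ge0 ?hW ?hU.
Qed.

Lemma radial_divergence_bounded : exists2 M, 0 <= M & forall x, `|H x| <= M.
Proof.
have [W W0 hW] := weight_bounded.
have [U U0 hU] := abs_powR_bounded (ltW p0).
have [V V0 hV] : exists2 M, 0 <= M & forall x, K x -> `|u x| `^ (p - 1) <= M.
  by apply: abs_powR_bounded; rewrite subr_ge0 ltW.
have [G G0 hG] := grad_bounded.
have [Q Q0 hQ] := quad_powR_bounded.
have [r0 [r1 [r00 r10 rK]]] := support_enorm_bounds cK K0.
pose g := `|d%:R - (p + beta)|.
have g0 : 0 <= g by exact: normr_ge0.
exists ((p * 1 * V * (r1 * G) + (g + Q) * U) * W).
  by rewrite mulr_ge0// addr_ge0// !mulr_ge0// ?(ltW p0) ?(ltW r10)// addr_ge0.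
move=> x; have [Kx|/radial_divergence_off->] := pselect (K x); last first.
  by rewrite normr0 mulr_ge0// addr_ge0// !mulr_ge0// ?(ltW p0) ?(ltW r10)// addr_ge0.
rewrite normrM (ger0_norm (weight_ge0 _)) ler_pM ?weight_ge0 ?hW//.
rewrite (le_trans (ler_normD _ _))// lerD//.
  rewrite !normrM (gtr0_norm p0) (ger0_norm (powR_ge0 _ _)).
  apply: ler_pM; rewrite ?mulr_ge0 ?powR_ge0 ?(ltW p0)//.
    apply: ler_pM; rewrite ?mulr_ge0 ?powR_ge0 ?(ltW p0) ?hV//.
    by apply: ler_pM; rewrite ?(ltW p0)// normr_sg; case: (_ == _).
  rewrite (le_trans (radial_derivative_le _))// ler_pM ?enorm_ge0 ?hG//.
  by have /andP[] := rK _ Kx.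
rewrite normrM (ger0_norm (powR_ge0 _ _)) ler_pM ?powR_ge0 ?hU//.
by rewrite (le_trans (ler_normB _ _))// lerD// ger0_norm ?powR_ge0// hQ.
Qed.

End radial_identity_integral.

(** * The radial divergence has integral zero *)

Section zero_mean.
Context {R : realType} (d : nat).
Variables (p c beta : R) (A : 'M[R]_d) (u : 'rV[R]_d -> R).
Hypotheses (p1 : 1 < p) (c0 : 0 < c) (A0 : forall x, 0 <= quad A x).
Hypotheses (smooth_u : smooth u).
Local Notation K := (closure [set x | u x != 0]).
Hypotheses (cK : compact K) (K0 : ~ K 0).
Local Notation F := (weighted_power p c beta A u).
Local Notation H := (radial_divergence p c beta A u).
Local Notation leb := (lebesgue_rV d).

Let s_ n : R := 1 + n.+1%:R^-1.
Let D n x := n.+1%:R * (s_ n ^+ d * F (s_ n *: x) - F x).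

Let s_ge1 n : 1 <= s_ n. Proof. by rewrite lerDl invr_ge0. Qed.
Let s_gt0 n : 0 < s_ n. Proof. exact: lt_le_trans (s_ge1 n). Qed.
Let s_le2 n : s_ n <= 2.
Proof. by rewrite -[2]/(1 + 1) lerD2l invf_le1// ler1n. Qed.

Let F0 x : 0 <= F x.
Proof. by rewrite mulr_ge0 ?powR_ge0//; exact: weight_ge0. Qed.

Let mF : measurable_fun setT F.
Proof. exact: measurable_weighted_power. Qed.

(** Sequential form of the derivative at [1] along the ray. *)
Let cvgD x : D n x @[n --> \oo] --> H x.
Proof.
have [dF dE] := is_derive_weighted_power_ray c beta p1 A0 smooth_u x.
have : (fun h : R => h^-1 *: ((h *: (1 : R) + 1) ^+ d * F ((h *: (1 : R) + 1 : R) *: x)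
   - 1 ^+ d * F ((1 : R) *: x))) @ 0^' --> H x.
  by rewrite -dE; exact: dF.
move=> /cvgr_dnbhsP /(_ (@harmonic R)) h.
have /h : (forall n, harmonic n != 0 :> R) /\ harmonic @ \oo --> (0 : R).
  by split; [move=> n; rewrite /harmonic /= invr_eq0|exact: cvg_harmonic].
apply: cvg_trans; apply: near_eq_cvg; near=> n.
rewrite /= /harmonic /= invrK expr1n mul1r scale1r /D /s_.
by rewrite -[_ *: 1]/(_ * 1) mulr1 [_ + 1]addrC.
Unshelve. all: by end_near. Qed.

(** A divergence theorem that needs no boundary and no coordinates: the integral
    of [s ^+ d * F (s *: x)] does not depend on [s], so the difference quotients
    [D n] have integral [0]; they converge to [H] pointwise, and dominatedly by
    the mean value theorem. *)
Lemma integral_radial_divergence :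
  (\int[leb]_x (H x)%:E = 0)%E.
Proof.
have [r0 [r1 [r00 r10 rK]]] := support_enorm_bounds cK K0.
have [M M0 hM] := radial_divergence_bounded beta p1 c0 A0 smooth_u cK K0.
have [N N0 hN] := weighted_power_bounded beta A p1 c0 smooth_u cK K0.
have Foff x : r1 < enorm x -> F x = 0.
  move=> r1x; apply: weighted_power_off => // Kx.
  by have /andP[_] := rK _ Kx; rewrite leNgt r1x.
have Foffs n x : r1 < enorm x -> F (s_ n *: x) = 0.
  move=> r1x; apply: Foff; rewrite enormZ ?(ltW (s_gt0 n))//.
  by rewrite (lt_le_trans r1x)// ler_peMl ?enorm_ge0.
have mFs1 n : measurable_fun setT (fun x : 'rV[R]_d => F (s_ n *: x)).
  exact: (measurableT_comp mF (measurable_scaler_rV _)).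
have mFs n : measurable_fun setT (fun x : 'rV[R]_d => s_ n ^+ d * F (s_ n *: x)).
  by apply: measurable_funM (mFs1 n); exact: measurable_cst.
have iF : leb.-integrable setT (EFin \o F).
  exact: (bounded_integrable_rV mF (ltW r10) hN Foff).
have iFs n : leb.-integrable setT (EFin \o (fun x : 'rV[R]_d => s_ n ^+ d * F (s_ n *: x))).
  apply: (bounded_integrable_rV (mFs n) (ltW r10) (M := s_ n ^+ d * N)).
    move=> x; rewrite normrM ger0_norm ?exprn_ge0 ?(ltW (s_gt0 n))//.
    by rewrite ler_wpM2l ?exprn_ge0 ?(ltW (s_gt0 n)).
  by move=> x /(Foffs n) ->; rewrite mulr0.
have mEF : measurable_fun setT (EFin \o F) by exact/measurable_EFinP.
have F0E x : (0 <= (EFin \o F) x)%E by rewrite lee_fin.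
have intD n : (\int[leb]_x (D n x)%:E = 0)%E.
  transitivity (n.+1%:R%:E * \int[leb]_x (((s_ n ^+ d * F (s_ n *: x))%R)%:E - (F x)%:E))%E.
    by rewrite -integralZl//; exact: (integrableB _ (iFs n) iF).
  rewrite integralB_EFin//.
  suff -> : (\int[leb]_x (s_ n ^+ d * F (s_ n *: x))%:E = \int[leb]_x (F x)%:E)%E.
    by rewrite subee ?mule0//; exact: (integrable_fin_num _ iF).
  under eq_integral do rewrite EFinM.
  have sd0 : (0 <= (s_ n ^+ d)%:E)%E by rewrite lee_fin exprn_ge0// ltW.
  have mEFs : measurable_fun setT (fun x : 'rV[R]_d => (F (s_ n *: x))%:E).
    by apply/measurable_EFinP; exact: mFs1.
  rewrite (ge0_integralZl _ measurableT mEFs (fun x _ => F0E (s_ n *: x)) sd0).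
  apply: etrans (congr1 (mule _) (integral_lebesgue_rV_dilation (s_gt0 n) mEF F0E)) _.
  by rewrite muleA -EFinM divff ?mul1e// expf_neq0// gt_eqF.
pose E : set 'rV[R]_d := (@enorm R d) @^-1` `]-oo, r1].
have mE : measurable E.
  by rewrite -[X in measurable X]setTI; exact: measurable_enorm.
have xE x : (x \in E) = (enorm x <= r1).
  by apply/idP/idP; rewrite inE /E/= in_itv.
pose g x : R := 2 ^+ d * M * \1_E x.
have mg : measurable_fun setT g by apply: measurable_funM.
have g0 x : 0 <= g x by rewrite !mulr_ge0 ?exprn_ge0.
have Dg n x : `|D n x| <= g x.
  rewrite /g indicE xE.
  case: (leP (enorm x) r1) => [xr1|r1x]; last first.
    by rewrite /D (Foffs _ _ r1x) (Foff _ r1x) mulr0 subrr mulr0 normr0 mulr0.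
  rewrite mulr1.
  pose phi (r : R) := r ^+ d * F (r *: x).
  have dphi (r : R) : 0 < r -> is_derive r 1 phi (r ^+ d * H (r *: x) / r).
    by move=> r_gt0; exact: is_derive_weighted_power_at.
  have [||r] := @MVT_segment R phi (fun r => r ^+ d * H (r *: x) / r) 1 (s_ n) (s_ge1 n).
  - by move=> r; rewrite in_itv/= => /andP[r1' _]; apply: dphi; exact: lt_trans r1'.
  - apply: continuous_in_subspaceT => r; rewrite inE/= in_itv/= => /andP[r1' _].
    apply: differentiable_continuous; apply/derivable1_diffP.
    by have [] := dphi r (lt_le_trans ltr01 r1').
  rewrite in_itv/= => /andP[r1' r2] E'.
  have -> : D n x = r ^+ d * H (r *: x) / r.
    have F1 : F x = phi 1 by rewrite /phi expr1n mul1r scale1r.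
    rewrite /D F1 -/(phi (s_ n)) E'.
    have -> : s_ n - 1 = n.+1%:R^-1 by rewrite /s_ [1 + _]addrC addrK.
    by rewrite mulrCA divff// mulr1.
  have rp : 0 < r := lt_le_trans ltr01 r1'.
  rewrite (normrM _ r^-1) (normrM (r ^+ d)) normfV (gtr0_norm rp).
  rewrite ler_pdivrMr// -[leLHS]mulr1; apply: ler_pM => //.
  apply: ler_pM => //; rewrite normrX gtr0_norm//.
  by rewrite lerXn2r ?nnegrE ?(ltW rp)// (le_trans r2).
have ig : leb.-integrable setT (EFin \o g).
  apply: (bounded_integrable_rV mg (ltW r10) (M := 2 ^+ d * M)).
    move=> x; rewrite ger0_norm// /g indicE.
    by case: (x \in E); rewrite ?mulr1 ?mulr0// mulr_ge0// exprn_ge0.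
  by move=> x r1x; rewrite /g indicE xE leNgt r1x mulr0.
have mD n : measurable_fun setT (EFin \o D n).
  apply/measurable_EFinP; apply: measurable_funM; first exact: measurable_cst.
  by apply: measurable_funB mF; exact: mFs.
have mH : measurable_fun setT (EFin \o H).
  by apply/measurable_EFinP; exact: measurable_radial_divergence.
have cvgDE : {ae leb, forall x, setT x -> (EFin \o D n) x @[n --> \oo] --> (EFin \o H) x}.
  by apply: aeW => x _; apply: cvg_EFin; [exact: nearW|exact: cvgD].
have domD : {ae leb, forall x n, setT x -> (`|(EFin \o D n) x| <= (EFin \o g) x)%E}.
  by apply: aeW => x n _; rewrite lee_fin.
have [_ _] := dominated_convergence measurableT mD mH cvgDE ig domD.
have -> : [sequence (\int[leb]_x (EFin \o D n) x)%E]_n = cst 0%E.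
  by apply/funext => n; exact: intD.
by move=> /(cvg_lim (@ereal_hausdorff R)) <-; exact: lim_cst.
Qed.

End zero_mean.

(** * The Hardy inequality *)

Section mu_rho_integral.
Context {R : realType} (d : nat).
Variables (p c : R) (A : 'M[R]_d).
Hypothesis c0 : 0 <= c.

Lemma integral_mu_rho (D : set 'rV[R]_d) (f : 'rV[R]_d -> R) :
  measurable D -> measurable_fun setT f -> (forall x, 0 <= f x) ->
  (\int[mu_rho p c A]_(x in D) (f x)%:E =
   \int[lebesgue_rV d]_(x in D) (f x * rho p c A x)%:E)%E.
Proof.
move=> mD mf f0.
have := @ge0_integral_density _ _ R (mu_rho p c A) (lebesgue_rV d) (rho p c A).
move=> /(_ c0); apply => //; first exact: measurable_rho.
by move=> x; exact: rho_ge0.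
Qed.

Lemma measurable_Omega : measurable (@Omega R d : set 'rV[R]_d).
Proof.
rewrite /Omega; case: ifP => _; last exact: measurableT.
rewrite (_ : @half_line R d = \bigcap_(i in [set: 'I_d])
    ((fun x : 'rV[R]_d => x ord0 i) @^-1` `]0, +oo[%classic)).
  apply: fin_bigcap_measurable => // i _; rewrite -[X in measurable X]setTI.
  exact: measurable_coord_rV.
apply/seteqP; split=> [x h i _|x h i]; first by rewrite /= in_itv/= andbT h.
by have := h i I; rewrite /= in_itv/= andbT.
Qed.

Lemma integral_Omega (f : 'rV[R]_d -> \bar R) :
  (forall x, ~ Omega x -> f x = 0%E) ->
  (\int[lebesgue_rV d]_(x in @Omega R d) f x = \int[lebesgue_rV d]_x f x)%E.
Proof.
move=> f0; rewrite integral_mkcond; apply: eq_integral => x _.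
by rewrite patchE; case: ifPn => // /negP; rewrite inE => /f0.
Qed.

End mu_rho_integral.

Section young.
Context {R : realType}.

(** Young's inequality for the conjugate exponents [p] and [p / (p - 1)]. *)
Lemma young_powR (p a b : R) : 1 < p -> 0 <= a -> 0 <= b ->
  p * (a `^ (p - 1) * b) <= (p - 1) * a `^ p + b `^ p.
Proof.
move=> p1 a0 b0; have p0 : 0 < p := lt_trans ltr01 p1.
have q0 : 0 < p / (p - 1) by rewrite divr_gt0 ?subr_gt0.
have p1n : p - 1 != 0 by rewrite gt_eqF ?subr_gt0.
have pq : p^-1 + (p / (p - 1))^-1 = 1 by field; rewrite p1n gt_eqF.
have := conjugate_powR b0 (powR_ge0 a (p - 1)) p0 q0 pq.
rewrite -powRrM (mulrC (p - 1)) divfK// => h.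
have -> : p * (a `^ (p - 1) * b) = (b * a `^ (p - 1)) * p by ring.
apply: le_trans (ler_wpM2r (ltW p0) h) _.
rewrite le_eqVlt; apply/orP; left; apply/eqP; field.
by rewrite p1n gt_eqF.
Qed.

End young.

Section hardy.
Context {R : realType} (d : nat).
Variables (p c beta : R) (A : 'M[R]_d) (u : 'rV[R]_d -> R).
Hypotheses (p1 : 1 < p) (c0 : 0 < c) (A0 : forall x, 0 <= quad A x).
Hypotheses (smooth_u : smooth u).
Local Notation K := (closure [set x | u x != 0]).
Hypotheses (cK : compact K) (K0 : ~ K 0).
Local Notation F := (weighted_power p c beta A u).
Local Notation H := (radial_divergence p c beta A u).
Local Notation leb := (lebesgue_rV d).
Local Notation C := (hardy_constant d p beta).
Local Notation sg := (Num.sg (d%:R - (p + beta))).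

(** [weight] at parameter [beta - p] carries the power [- beta] of the norm. *)
Definition gradient_density (x : 'rV[R]_d) : R :=
  enorm (grad u x) `^ p * weight p c (beta - p) A x.

Definition quad_density (x : 'rV[R]_d) : R := quad A x `^ (p / 2) * F x.

Let p0 : 0 < p. Proof. exact: lt_trans p1. Qed.

(** Multiplying the divergence by [C `^ (p - 1) * sg] turns its term
    [(d - (p + beta)) |u|^p] into [p C^p |u|^p]. Of these [p] copies, Young's
    inequality for [C |u|] and [|x| |grad u|] consumes [p - 1] to absorb the term
    with the radial derivative, and one copy remains. *)
Lemma hardy_pointwise x : x != 0 ->
  C `^ p * F x <= gradient_density x + C `^ (p - 1) * sg * quad_density x
                  + C `^ (p - 1) * sg * H x.
Proof.
move=> xn0; have r0 := enorm_gt0 xn0.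
set r := enorm x in r0 *; set U := `|u x|; set G := enorm (grad u x).
set E := radial_derivative u x; set Q := quad A x `^ (p / 2).
set W := weight p c beta A x; set g := d%:R - (p + beta).
have C0 : 0 <= C by rewrite divr_ge0 ?normr_ge0 ?ltW.
have W0 : 0 <= W by exact: weight_ge0.
have WE : weight p c (beta - p) A x = r `^ p * W.
  rewrite /W /weight -/r mulrA -powRD; last by apply/implyP => _; rewrite gt_eqF.
  by congr (_ `^ _ * _); ring.
have Cg : C `^ (p - 1) * sg * g = p * C `^ p.
  rewrite -(mulr_powRB1 C0 p0) -mulrA -[sg * g]normrEsg /hardy_constant -/g.
  by field; rewrite gt_eqF.
have key : 0 <= (p - 1) * (C * U) `^ p + (r * G) `^ p
     + C `^ (p - 1) * sg * (p * Num.sg (u x) * U `^ (p - 1) * E).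
  have Y := young_powR p1 (mulr_ge0 C0 (normr_ge0 (u x)))
    (mulr_ge0 (ltW r0) (enorm_ge0 (grad u x))).
  rewrite -subr_ge0 in Y; rewrite -/U -/G in Y.
  apply: le_trans Y _; rewrite lerD2l.
  rewrite lerNl; apply: le_trans (ler_norm _) _.
  rewrite normrN !normrM (gtr0_norm p0) !(ger0_norm (powR_ge0 _ _)).
  rewrite (powRM _ C0 (normr_ge0 _)) -!mulrA.
  have -> : C `^ (p - 1) * (`|sg| * (p * (`|Num.sg (u x)| * (U `^ (p - 1) * `|E|)))) =
     p * (C `^ (p - 1) * (U `^ (p - 1) * (`|sg| * `|Num.sg (u x)| * `|E|))) by ring.
  apply: ler_wpM2l; first exact: ltW.
  do 2 (apply: ler_wpM2l; first exact: powR_ge0).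
  apply: le_trans (radial_derivative_le u x).
  rewrite -[leRHS]mul1r ler_wpM2r// -[leRHS]mul1r ler_pM// normr_sg lern1; exact: leq_b1.
rewrite /gradient_density /quad_density /weighted_power /radial_divergence.
rewrite WE -/U -/G -/E -/Q -/W -/g -subr_ge0.
have -> : G `^ p * (r `^ p * W) + C `^ (p - 1) * sg * (Q * (U `^ p * W)) +
  C `^ (p - 1) * sg * ((p * Num.sg (u x) * U `^ (p - 1) * E + (g - Q) * U `^ p) * W)
  - C `^ p * (U `^ p * W) =
  ((r * G) `^ p - C `^ p * U `^ p + (C `^ (p - 1) * sg * g) * U `^ p
   + C `^ (p - 1) * sg * (p * Num.sg (u x) * U `^ (p - 1) * E)) * W.
  by rewrite (powRM _ (ltW r0) (enorm_ge0 _)); ring.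
apply: mulr_ge0 => //; rewrite Cg; move: key.
rewrite (powRM _ C0 (normr_ge0 _)) -/U; lra.
Qed.

Lemma integrable_on_support (f : 'rV[R]_d -> R) (M : R) :
  measurable_fun setT f -> 0 <= M -> (forall x, K x -> `|f x| <= M) ->
  (forall x, ~ K x -> f x = 0) -> leb.-integrable setT (EFin \o f).
Proof.
move=> mf M0 fM f0; have [r0 [r1 [r00 r10 rK]]] := support_enorm_bounds cK K0.
apply: (bounded_integrable_rV mf (ltW r10) (M := M)) => x.
  by have [/fM//|/f0->] := pselect (K x); rewrite normr0.
move=> r1x; apply: f0 => /rK /andP[_].
by rewrite leNgt r1x.
Qed.

Let F0 x : 0 <= F x.
Proof. by rewrite mulr_ge0 ?powR_ge0//; exact: weight_ge0. Qed.

Lemma integrable_weighted_power : leb.-integrable setT (EFin \o F).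
Proof.
have [M M0 hM] := weighted_power_bounded beta A p1 c0 smooth_u cK K0.
apply: (integrable_on_support _ M0) => //; first exact: measurable_weighted_power.
by move=> x /weighted_power_off; apply.
Qed.

Lemma integrable_radial_divergence : leb.-integrable setT (EFin \o H).
Proof.
have [M M0 hM] := radial_divergence_bounded beta p1 c0 A0 smooth_u cK K0.
apply: (integrable_on_support _ M0) => //; first exact: measurable_radial_divergence.
by move=> x /radial_divergence_off; apply.
Qed.

Lemma measurable_quad_density : measurable_fun setT quad_density.
Proof.
apply: measurable_funM; first exact: measurable_quad_powR.
exact: measurable_weighted_power.
Qed.

Lemma quad_density_ge0 x : 0 <= quad_density x.
Proof. by rewrite mulr_ge0 ?powR_ge0. Qed.

Lemma integrable_quad_density : leb.-integrable setT (EFin \o quad_density).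
Proof.
have [M M0 hM] := weighted_power_bounded beta A p1 c0 smooth_u cK K0.
have [Q Q0 hQ] := quad_powR_bounded p1 A0 cK K0.
apply: (integrable_on_support _ (mulr_ge0 Q0 M0)).
- exact: measurable_quad_density.
- move=> x Kx; rewrite normrM ler_pM ?normr_ge0// ger0_norm ?powR_ge0//.
  exact: hQ.
- by move=> x Kx; rewrite /quad_density weighted_power_off ?mulr0.
Qed.

Lemma measurable_grad_powR (r : R) :
  measurable_fun setT (fun x => enorm (grad u x) `^ r).
Proof.
apply: (measurableT_comp (measurable_powR _)).
apply: (measurableT_comp (@measurable_enorm R d)).
apply: measurable_fun_rV => i.
rewrite (_ : (fun _ => _) = partial i u); last by apply/funext => x; rewrite mxE.
by apply: continuous_measurable_rV; exact: smooth_partial_continuous.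
Qed.

Lemma measurable_gradient_density : measurable_fun setT gradient_density.
Proof.
by apply: measurable_funM (measurable_weight _ _ _ _); exact: measurable_grad_powR.
Qed.

Lemma gradient_density_ge0 x : 0 <= gradient_density x.
Proof. by rewrite mulr_ge0 ?powR_ge0//; exact: weight_ge0. Qed.

Lemma gradient_density_off x : ~ K x -> gradient_density x = 0.
Proof.
move=> /off_support[_ du].
have -> : gradient_density x = enorm (0 : 'rV[R]_d) `^ p * weight p c (beta - p) A x.
  by rewrite /gradient_density (_ : grad u x = 0)//; apply/rowP => i; rewrite !mxE.
rewrite (_ : enorm 0 = 0) ?powR0 ?mul0r ?gt_eqF//.
by rewrite -(scale0r 0) enormZ// mul0r.
Qed.

Lemma integrable_gradient_density : leb.-integrable setT (EFin \o gradient_density).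
Proof.
have [G G0 hG] := grad_bounded smooth_u cK.
have [W W0 hW] := weight_bounded (beta - p) A p1 c0 cK K0.
apply: (integrable_on_support _ (mulr_ge0 (powR_ge0 G p) W0)).
- exact: measurable_gradient_density.
- move=> x Kx; rewrite ger0_norm ?gradient_density_ge0//.
  apply: ler_pM; rewrite ?powR_ge0 ?weight_ge0//; last exact: hW.
  by apply: ge0_ler_powR; rewrite ?nnegrE ?enorm_ge0 ?(ltW p0) ?hG.
- exact: gradient_density_off.
Qed.

(** Integrate the pointwise inequality: the divergence term disappears. *)
Lemma hardy_inequality_lebesgue :
  ((C `^ p)%:E * \int[leb]_x (F x)%:E <=
   \int[leb]_x (gradient_density x)%:E
   + (C `^ (p - 1) * sg)%:E * \int[leb]_x (quad_density x)%:E)%E.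
Proof.
set kappa := C `^ (p - 1) * sg.
have iF := integrable_weighted_power; have iH := integrable_radial_divergence.
have iq := integrable_quad_density; have ig := integrable_gradient_density.
rewrite -(integralZl measurableT iF).
have -> : (\int[leb]_x (gradient_density x)%:E + kappa%:E * \int[leb]_x (quad_density x)%:E
   = \int[leb]_x (((gradient_density x)%:E + kappa%:E * (quad_density x)%:E)
        + kappa%:E * (H x)%:E))%E.
  have ikq := integrableZl measurableT kappa iq.
  have ikH := integrableZl measurableT kappa iH.
  rewrite (integralD measurableT (integrableD measurableT ig ikq) ikH).
  rewrite (integralD measurableT ig ikq) (integralZl measurableT iq).
  rewrite (integralZl measurableT iH) (integral_radial_divergence beta p1 c0 A0 smooth_u cK K0).
  by rewrite mule0 adde0.
apply: le_integral => //.
- exact: integrableZl.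
- apply: integrableD => //; last exact: integrableZl.
  by apply: integrableD => //; exact: integrableZl.
- move=> x _; have [->|xn0] := eqVneq x 0.
    rewrite /= weighted_power_off// gradient_density_off//.
    rewrite /quad_density weighted_power_off// radial_divergence_off//.
    by rewrite !mulr0 !mule0 !add0e.
  by rewrite -!EFinM -!EFinD lee_fin; exact: hardy_pointwise.
Qed.

(** Integrands supported in [Omega] may be integrated over the whole space, on
    which dilations act. *)
Lemma integral_mu_rho_Omega (f g : 'rV[R]_d -> R) : K `<=` @Omega R d ->
  measurable_fun setT f -> (forall x, 0 <= f x) ->
  (forall x, f x * rho p c A x = g x) -> (forall x, ~ K x -> g x = 0) ->
  (\int[mu_rho p c A]_(x in @Omega R d) (f x)%:E = \int[leb]_x (g x)%:E)%E.
Proof.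
move=> KO mf f0 fg goff.
rewrite integral_mu_rho ?(ltW c0)//; last exact: measurable_Omega.
rewrite integral_Omega; first by apply: eq_integral => x _; rewrite fg.
by move=> x Ox; rewrite fg goff// => /KO.
Qed.

Lemma integral_hardy_lhs : K `<=` @Omega R d ->
  (\int[mu_rho p c A]_(x in @Omega R d) (`|u x| `^ p / enorm x `^ (p + beta))%:E =
   \int[leb]_x (F x)%:E)%E.
Proof.
move=> KO; apply: integral_mu_rho_Omega => //.
- apply: (eq_measurable_fun (fun x => `|u x| `^ p * enorm x `^ (- (p + beta)))).
    by move=> x _; rewrite powRN.
  by apply: measurable_funM (measurable_enorm_powR _); exact: measurable_abs_powR.
- by move=> x; rewrite divr_ge0 ?powR_ge0.
- by move=> x; rewrite /weighted_power /weight powRN mulrA.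
- by move=> x; exact: weighted_power_off.
Qed.

Lemma integral_hardy_gradient : K `<=` @Omega R d ->
  (\int[mu_rho p c A]_(x in @Omega R d) (enorm (grad u x) `^ p / enorm x `^ beta)%:E =
   \int[leb]_x (gradient_density x)%:E)%E.
Proof.
move=> KO; apply: integral_mu_rho_Omega => //.
- apply: (eq_measurable_fun (fun x => enorm (grad u x) `^ p * enorm x `^ (- beta))).
    by move=> x _; rewrite powRN.
  by apply: measurable_funM (measurable_enorm_powR _); exact: measurable_grad_powR.
- by move=> x; rewrite divr_ge0 ?powR_ge0.
- move=> x; rewrite /gradient_density /weight mulrA -powRN.
  by congr (_ * _ `^ _ * _); ring.
- by move=> x; exact: gradient_density_off.
Qed.

Lemma integral_hardy_quad : K `<=` @Omega R d ->
  (\int[mu_rho p c A]_(x in @Omega R d)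
     (`|u x| `^ p * quad A x `^ (p / 2) / enorm x `^ (p + beta))%:E =
   \int[leb]_x (quad_density x)%:E)%E.
Proof.
move=> KO; apply: integral_mu_rho_Omega => //.
- apply: (eq_measurable_fun (fun x =>
      `|u x| `^ p * quad A x `^ (p / 2) * enorm x `^ (- (p + beta)))).
    by move=> x _; rewrite powRN.
  apply: measurable_funM (measurable_enorm_powR _).
  by apply: measurable_funM (measurable_quad_powR _ _); exact: measurable_abs_powR.
- by move=> x; rewrite divr_ge0 ?mulr_ge0 ?powR_ge0.
- by move=> x; rewrite /quad_density /weighted_power /weight powRN; ring.
- by move=> x Kx; rewrite /quad_density weighted_power_off ?mulr0.
Qed.

Lemma hardy_inequality_on_Omega : K `<=` @Omega R d ->
  hardy_inequality p c beta A (C `^ p) u.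
Proof.
move=> KO; rewrite /hardy_inequality integral_hardy_lhs// integral_hardy_gradient//.
rewrite integral_hardy_quad//; exact: hardy_inequality_lebesgue.
Qed.

End hardy.

(** * Smooth functions of one variable *)

Section smooth_functions_of_one_variable.
Context {R : realType}.

(** The family is closed under differentiation up to linear combinations; [flat 0]
    is the classical smooth function that is flat at [0]. *)
Definition flat (k : nat) (t : R) : R :=
  if 0 < t then t ^- k * expR (- t^-1) else 0.

(** A class of functions closed under differentiation, hence smooth, and large
    enough for the test functions. Real powers are singular at [0] and only enter
    through [cinf_cut_powR], multiplied by a function vanishing near [0]. *)
Inductive cinf : (R -> R) -> Prop :=
| cinf_flat k : cinf (flat k)
| cinf_cst a : cinf (fun=> a)
| cinf_id : cinf (fun t => t)
| cinf_add f g : cinf f -> cinf g -> cinf (fun t => f t + g t)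
| cinf_mul f g : cinf f -> cinf g -> cinf (fun t => f t * g t)
| cinf_comp f g : cinf f -> cinf g -> cinf (fun t => f (g t))
| cinf_cut_powR f a b : cinf f -> 0 < a -> (forall t, t < a -> f t = 0) ->
    cinf (fun t => f t * t `^ b).

Lemma is_derive_near0 (f : R -> R) (x : R) :
  (\forall y \near x, f y = 0) -> is_derive x 1 f 0.
Proof.
move=> f0; apply: near_eq_is_derive (is_derive_cst (0 : R) x (1 : R)).
by apply: filterS f0 => y ->.
Qed.

(** One term of the exponential series beats the negative power. *)
Lemma flat_bound k (t : R) : 0 < t -> t ^- k.+1 * expR (- t^-1) <= k.+2`!%:R * t.
Proof.
move=> t0; have ti0 : 0 <= t^-1 by rewrite invr_ge0 ltW.
rewrite expRN ler_pdivrMr ?expR_gt0//.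
apply: (@le_trans _ _ (k.+2`!%:R * t * (t^-1 ^+ k.+2 / k.+2`!%:R))).
  rewrite le_eqVlt; apply/orP; left; apply/eqP.
  rewrite exprVn [t ^+ k.+2]exprS invfM; set X := (t ^+ k.+1)^-1.
  have N0 : k.+2`!%:R != 0 :> R by rewrite pnatr_eq0 -lt0n fact_gt0.
  have tn0 : t != 0 by rewrite gt_eqF.
  by field; rewrite ?N0 ?tn0.
apply: ler_wpM2l; first by rewrite mulr_ge0 ?(ltW t0).
by apply: le_trans (expR_ge1Dxn k.+1 ti0); rewrite lerDr.
Qed.

Lemma is_derive_flat k (x : R) :
  is_derive x 1 (flat k) (flat k.+2 x + - k%:R * flat k.+1 x).
Proof.
have [x0|x0|->] := ltgtP x 0.
- rewrite /flat !ltNge (ltW x0)/= mulr0 addr0; apply: is_derive_near0.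
  near=> y; rewrite ltNge; case: leP => //; rewrite ltNge => /negP; case.
  by apply: ltW; near: y; exact: lt_nbhsl.
- have xn0 : x != 0 by rewrite gt_eqF.
  pose G (t : R) := t^-1 ^+ k * expR (- t^-1).
  apply: (@near_eq_is_derive _ _ _ G).
    near=> y; rewrite /G /flat exprVn ifT//; near: y; exact: lt_nbhsr.
  have DV : is_derive x 1 (fun t : R => t^-1) (- x ^- 2).
    have := is_deriveV xn0 (is_derive_id x (1 : R)).
    by rewrite [_ *: 1]mulr1.
  have DE : is_derive x 1 (fun t : R => expR (- t^-1)) (expR (- x^-1) * x ^- 2).
    have := is_derive1_comp (is_derive_expR _) (is_deriveN DV).
    by rewrite opprK.
  have DX := is_deriveX k DV; rewrite exprfctE in DX.
  apply: (is_derive_eq (is_deriveM DX DE)).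
  rewrite /flat x0 /GRing.scale/= !exprVn.
  case: k {G DX} => [|k]; first by rewrite !expr0 invr1 /=; field.
  have X0 : x ^+ k != 0 by rewrite expf_neq0.
  by rewrite /= !exprS; field; rewrite xn0 X0.
- rewrite /flat ltxx mulr0 addr0.
  suff : (fun h : R => h^-1 *: (flat k (h *: (1 : R) + 0) - flat k 0)) @ 0^' --> (0 : R).
    move=> h; constructor; first by apply/cvg_ex; eexists; exact: h.
    by apply/cvg_lim.
  apply/cvgrPdist_le => e e0.
  have N0 : 0 < k.+2`!%:R :> R by rewrite ltr0n fact_gt0.
  near=> h.
  have h0 : h != 0 by near: h; exact: nbhs_dnbhs_neq.
  rewrite addr0 -[h *: 1]/(h * 1) mulr1 -[_ *: _]/(_ * _) sub0r normrN {2}/flat ltxx subr0.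
  rewrite /flat; case: ifPn => [hp|_]; last by rewrite mulr0 normr0 ltW.
  have -> : h^-1 * (h ^- k * expR (- h^-1)) = h ^- k.+1 * expR (- h^-1).
    by rewrite mulrA exprS invfM.
  rewrite ger0_norm ?mulr_ge0 ?expR_ge0 ?invr_ge0 ?exprn_ge0 ?(ltW hp)//.
  apply: le_trans (flat_bound _ hp) _; rewrite mulrC -ler_pdivlMr//.
  apply: le_trans (ler_norm _) _; apply: ltW.
  by near: h; apply: dnbhs0_lt; exact: divr_gt0.
Unshelve. all: by end_near. Qed.

Lemma cinf_derive f : cinf f -> exists2 f', cinf f' & forall x : R, is_derive x 1 f (f' x).
Proof.
elim=> [k|a||{}f g _ [f' Cf' df] _ [g' Cg' dg]|{}f g Cf [f' Cf' df] Cg [g' Cg' dg]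
  |{}f g Cf [f' Cf' df] Cg [g' Cg' dg]|{}f a b Cf [f' Cf' df] a0 fa].
- exists (fun t => flat k.+2 t + - k%:R * flat k.+1 t); last exact: is_derive_flat.
  apply: cinf_add; first exact: cinf_flat.
  by apply: cinf_mul; [exact: cinf_cst|exact: cinf_flat].
- by exists (fun=> 0); [exact: cinf_cst|move=> x; exact: is_derive_cst].
- by exists (fun=> 1); [exact: cinf_cst|move=> x; exact: is_derive_id].
- exists (fun t => f' t + g' t); first exact: cinf_add.
  by move=> x; exact: (is_deriveD (df x) (dg x)).
- exists (fun t => f t * g' t + g t * f' t).
    by apply: cinf_add; apply: cinf_mul.
  by move=> x; exact: (is_deriveM (df x) (dg x)).
- exists (fun t => f' (g t) * g' t).
    by apply: cinf_mul => //; exact: cinf_comp.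
  by move=> x; exact: (is_derive1_comp (df (g x)) (dg x)).
- have near_fa x : x < a -> \forall y \near x, f y = 0.
    by move=> xa; near=> y; apply: fa; near: y; exact: lt_nbhsl.
  have fa' x : x < a -> f' x = 0.
    move=> xa; have [_ <-] := df x.
    by have [_ ->] := is_derive_near0 (near_fa _ xa).
  exists (fun t => f' t * t `^ b + b * (f t * t `^ (b - 1))).
    apply: cinf_add; first exact: cinf_cut_powR fa'.
    by apply: cinf_mul; [exact: cinf_cst|exact: cinf_cut_powR fa].
  move=> x; have [xa|ax] := ltP x a.
    rewrite fa' ?fa// !mul0r mulr0 addr0; apply: is_derive_near0.
    by near=> y; rewrite (near (near_fa _ xa) y) ?mul0r.
  have x0 : 0 < x := lt_le_trans a0 ax.
  apply: (is_derive_eq (is_deriveM (df x) (@is_derive1_powR _ b x x0))).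
  by rewrite /GRing.scale/=; ring.
Unshelve. all: by end_near. Qed.

Lemma cinf_continuous f : cinf f -> continuous f.
Proof.
move=> /cinf_derive[f' _ df] x; apply: differentiable_continuous.
by apply/derivable1_diffP; case: (df x).
Qed.

End smooth_functions_of_one_variable.

Section smooth_step.
Context {R : realType}.

Lemma flat0_range (y : R) : y <= 1 -> 0 <= expR 1 * flat 0 y <= 1.
Proof.
move=> y1; rewrite /flat; case: ifPn => [y0|_]; last by rewrite mulr0 lexx ler01.
rewrite expr0 invr1 mul1r -expRD expR_ge0/= -[leRHS]expR0 ler_expR.
by rewrite subr_le0 invf_ge1.
Qed.

Lemma flat0_ge1 (y : R) : 1 <= y -> 1 <= expR 1 * flat 0 y.
Proof.
move=> y1; have y0 : 0 < y := lt_le_trans ltr01 y1.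
rewrite /flat y0 expr0 invr1 mul1r -expRD -[leLHS]expR0 ler_expR subr_ge0.
by rewrite invf_le1.
Qed.

(** Composing [flat 0] with itself gives a step without any division: the inner
    copy, rescaled by [expR 1], is at least [1] on one side, where the outer copy
    vanishes, and is [0] on the other, where the outer copy is constant. *)
Lemma smooth_step_exists : exists S S' : R -> R,
  [/\ cinf S, (forall t : R, is_derive t 1 S (S' t)), (forall t, 0 <= S t <= 1),
      (forall t, t <= 0 -> S t = 0) /\ (forall t, 1 <= t -> S t = 1) &
      (forall t, t <= 0 \/ 1 <= t -> S' t = 0) /\
      exists2 L, 0 <= L & forall t, `|S' t| <= L].
Proof.
(* the transition takes place inside [1/4, 3/4], so that the derivative vanishes
   at [0] and [1] because the step is locally constant there *)
pose h (t : R) : R := 1 + (- expR 1) * flat 0 (1 + (-1) * (2 * t + - 2^-1)).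
pose S (t : R) := expR 1 * flat 0 (h t).
have CS : cinf S.
  have C0 : cinf (flat 0 : R -> R) := cinf_flat 0.
  have Ca (x : R) := cinf_cst x; have Ci := @cinf_id R.
  have Cin : cinf (fun t : R => 1 + (-1) * (2 * t + - 2^-1)).
    apply: cinf_add => //; apply: cinf_mul => //; apply: cinf_add => //.
    exact: cinf_mul.
  apply: cinf_mul => //; apply: cinf_comp => //.
  apply: cinf_add => //; apply: cinf_mul => //; exact: (cinf_comp C0 Cin).
have S_0 t : t <= 4^-1 -> S t = 0.
  move=> t0; have : h t <= 0.
    rewrite /h [- expR 1 * _]mulNr subr_le0; apply: flat0_ge1; lra.
  by rewrite /S {1}/flat leNgt => /negbTE ->; rewrite mulr0.
have S_1 t : 3 / 4 <= t -> S t = 1.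
  move=> t1; have -> : S t = expR 1 * flat 0 1.
    rewrite /S /h [flat 0 (1 + -1 * _)]/flat ifF ?mulr0 ?addr0//.
    by apply/negbTE; rewrite -leNgt; lra.
  by rewrite /flat ltr01 expr0 invr1 mul1r -expRD subrr expR0.
have [S' CS' dS] := cinf_derive CS.
have S'0 t : t < 4^-1 -> S' t = 0.
  move=> t0; have [_ <-] := dS t.
  have /is_derive_near0 [_ ->//] : \forall y \near t, S y = 0.
  by near=> y; apply: S_0; apply: ltW; near: y; exact: lt_nbhsl.
have S'1 t : 3 / 4 < t -> S' t = 0.
  move=> t1; have [_ <-] := dS t.
  rewrite (@near_eq_derive _ _ _ S (cst 1)) ?derive_cst//.
  by near=> y; apply: S_1; apply: ltW; near: y; exact: lt_nbhsr.
have S'out t : t <= 0 \/ 1 <= t -> S' t = 0.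
  by move=> [t0|t1]; [apply: S'0; lra|apply: S'1; lra].
exists S, S'; split => //.
- by move=> t; apply: flat0_range; rewrite /h [- expR 1 * _]mulNr gerDl oppr_le0
    mulr_ge0 ?expR_ge0// /flat; case: ifPn => // y0;
    by rewrite mulr_ge0 ?expR_ge0 ?invr_ge0 ?exprn_ge0 ?(ltW y0).
- by split=> t tt; [apply: S_0; lra|apply: S_1; lra].
- split=> //.
  have [|M [_ Mb]] := @compact_bounded R R (S' @` `[0, 1]%classic).
    apply: continuous_compact; last exact: segment_compact.
    exact/continuous_subspaceT/cinf_continuous.
  exists (`|M| + 1); first by rewrite addr_ge0.
  move=> t; have [t0|t0] := leP t 0; first by rewrite S'out ?normr0 ?addr_ge0//; left.
  have [t1|t1] := leP 1 t; first by rewrite S'out ?normr0 ?addr_ge0//; right.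
  apply: (Mb (`|M| + 1)); first by rewrite (le_lt_trans (ler_norm _))// ltrDl.
  by exists t => //=; rewrite in_itv/= !ltW.
Unshelve. all: by end_near. Qed.

End smooth_step.

(** * Smooth functions on row vectors *)

Section smooth_functions_rV.
Context {R : realType} {d : nat}.

(** Again a class stable under partial derivatives, so that smoothness follows by
    induction on the list of derivatives. *)
Inductive cinf_rV : ('rV[R]_d -> R) -> Prop :=
| cinf_rV_cst a : cinf_rV (fun=> a)
| cinf_rV_coord i : cinf_rV (fun x => x ord0 i)
| cinf_rV_add f g : cinf_rV f -> cinf_rV g -> cinf_rV (fun x => f x + g x)
| cinf_rV_mul f g : cinf_rV f -> cinf_rV g -> cinf_rV (fun x => f x * g x)
| cinf_rV_comp w f : cinf w -> cinf_rV f -> cinf_rV (fun x => w (f x)).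

Lemma cinf_rV_sum n (f : 'I_n -> 'rV[R]_d -> R) :
  (forall i, cinf_rV (f i)) -> cinf_rV (fun x => \sum_i f i x).
Proof.
elim: n f => [|n IH] f fC.
  rewrite (_ : (fun _ => _) = fun=> 0); first exact: cinf_rV_cst.
  by apply/funext => x; rewrite big_ord0.
rewrite (_ : (fun _ => _) =
    fun x => f ord0 x + \sum_(i < n) f (lift ord0 i) x).
  by apply: cinf_rV_add => //; apply: IH.
by apply/funext => x; rewrite big_ord_recl.
Qed.

Lemma is_derive_comp_along (w : R -> R) (f : 'rV[R]_d -> R) x v (dw df : R) :
  is_derive (f x) 1 w dw -> is_derive x v f df ->
  is_derive x v (fun y => w (f y)) (dw * df).
Proof.
move=> Dw /is_derive_along Df; apply/is_derive_along.
apply: (@is_derive1_comp R w (fun s : R => f (s *: v + x)) 0) Df.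
by rewrite scale0r add0r.
Qed.

Lemma cinf_rV_continuous f : cinf_rV f -> continuous f.
Proof.
elim=> [a|i|{}f g _ cf _ cg|{}f g _ cf _ cg|w {}f Cw _ cf] x.
- exact: cst_continuous.
- exact: coord_continuous.
- exact: (continuousD (cf x) (cg x)).
- exact: (continuousM (cf x) (cg x)).
- by apply: (@continuous_comp _ _ _ f w x); [exact: cf|exact: cinf_continuous].
Qed.

Lemma cinf_rV_derive f i : cinf_rV f ->
  exists2 g, cinf_rV g & forall x, is_derive x (delta_mx ord0 i) f (g x).
Proof.
elim=> [a|j|{}f g Cf [f' Cf' df] Cg [g' Cg' dg]|{}f g Cf [f' Cf' df] Cg [g' Cg' dg]
  |w {}f Cw Cf [f' Cf' df]].
- by exists (fun=> 0); [exact: cinf_rV_cst|move=> x; exact: is_derive_cst].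
- exists (fun=> (delta_mx ord0 i : 'rV[R]_d) ord0 j); first exact: cinf_rV_cst.
  move=> x; apply/is_derive_along.
  rewrite (_ : (fun _ => _) = fun s : R => s * (delta_mx ord0 i : 'rV[R]_d) ord0 j
      + x ord0 j); last by apply/funext => s; rewrite !mxE.
  have D := is_deriveM (is_derive_id (0 : R) (1 : R))
    (is_derive_cst ((delta_mx ord0 i : 'rV[R]_d) ord0 j) (0 : R) (1 : R)).
  apply: (is_derive_eq (is_deriveD D (is_derive_cst (x ord0 j) (0 : R) (1 : R)))).
  by rewrite /GRing.scale/= mulr0 add0r mulr1 addr0.
- exists (fun x => f' x + g' x); first exact: cinf_rV_add.
  by move=> x; exact: (is_deriveD (df x) (dg x)).
- exists (fun x => f x * g' x + g x * f' x).
    by apply: cinf_rV_add; apply: cinf_rV_mul.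
  by move=> x; exact: (is_deriveM (df x) (dg x)).
- have [w' Cw' dw] := cinf_derive Cw.
  exists (fun x => w' (f x) * f' x).
    by apply: cinf_rV_mul => //; exact: cinf_rV_comp.
  by move=> x; exact: is_derive_comp_along.
Qed.

Lemma cinf_rV_smooth f : cinf_rV f -> smooth f.
Proof.
move=> Cf s; have {Cf} Cs : cinf_rV (foldr partial f s).
  elim: s => //= i s IH; have [g Cg dg] := cinf_rV_derive i IH.
  rewrite (_ : partial i _ = g)//.
  by apply/funext => x; rewrite /partial; have [] := dg x.
split; first exact: cinf_rV_continuous.
by move=> i x; have [g _ dg] := cinf_rV_derive i Cs; have [] := dg x.
Qed.

Lemma cinf_rV_sqr_norm : cinf_rV (fun x => \sum_i x ord0 i ^+ 2).
Proof.
apply: cinf_rV_sum => i; rewrite (_ : (fun _ => _) = fun x : 'rV[R]_d => x ord0 i * x ord0 i).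
  by apply: cinf_rV_mul; exact: cinf_rV_coord.
by apply/funext => x; rewrite expr2.
Qed.

Lemma is_derive_sqr_norm (x : 'rV[R]_d) i :
  is_derive x (delta_mx ord0 i) (fun y : 'rV[R]_d => \sum_j y ord0 j ^+ 2)
    (2 * x ord0 i).
Proof.
apply/is_derive_along.
rewrite (_ : (fun _ => _) = fun s : R => \sum_j x ord0 j ^+ 2
    + s * (2 * x ord0 i + s)); last first.
  apply/funext => s; rewrite (bigD1 i)//= [in RHS](bigD1 i)//= !mxE !eqxx mulr1.
  rewrite (eq_bigr (fun j => x ord0 j ^+ 2)); first by ring.
  by move=> j ji; rewrite !mxE eqxx/= (negbTE ji) mulr0 add0r.
have D1 := is_deriveD (is_derive_cst (2 * x ord0 i) (0 : R) (1 : R))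
  (is_derive_id (0 : R) (1 : R)).
have D := is_deriveD (is_derive_cst (\sum_j x ord0 j ^+ 2) (0 : R) (1 : R))
  (is_deriveM (is_derive_id (0 : R) (1 : R)) D1).
apply: (is_derive_eq D).
rewrite addrfctE /cst /GRing.scale/=; ring.
Qed.

End smooth_functions_rV.

(** * Mass of dyadic annuli *)

Section annuli.
Context {R : realType} (d : nat).
Hypothesis d_gt0 : (0 < d)%N.
Local Notation leb := (lebesgue_rV d).

Definition annulus (r s : R) : set 'rV[R]_d :=
  @Omega R d `&` [set x | r <= enorm x < s].

(** The density [|x|^(-d)] is invariant under dilations; in polar coordinates it is
    [dr / r], the extremal profile of the Hardy inequality. *)
Definition log_density (r s : R) (x : 'rV[R]_d) : R :=
  enorm x `^ (- d%:R) * \1_(annulus r s) x.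

Lemma measurable_annulus r s : measurable (annulus r s).
Proof.
apply: measurableI; first exact: measurable_Omega.
rewrite (_ : [set x | _] = (@enorm R d) @^-1` `[r, s[%classic); last first.
  by apply/seteqP; split=> x /=; rewrite in_itv.
by rewrite -[X in measurable X]setTI; exact: measurable_enorm.
Qed.

Lemma measurable_log_density r s : measurable_fun setT (log_density r s).
Proof.
apply: measurable_funM; first exact: measurable_enorm_powR.
by apply: measurable_indic; exact: measurable_annulus.
Qed.

Lemma log_density_ge0 r s x : 0 <= log_density r s x.
Proof. by rewrite mulr_ge0 ?powR_ge0. Qed.

Lemma mem_annulus r s x :
  (x \in annulus r s) = (x \in @Omega R d) && (r <= enorm x < s).
Proof.
apply/idP/idP; rewrite inE; first by move=> [Ox h]; rewrite mem_set.
by move=> /andP[/set_mem Ox h].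
Qed.

Lemma Omega_dilation (t : R) (x : 'rV[R]_d) : 0 < t -> Omega (t *: x) <-> Omega x.
Proof.
move=> t0; rewrite /Omega; case: ifP => _ //.
by split=> h i; have := h i; rewrite mxE pmulr_rgt0.
Qed.

Lemma log_density_dilation (t r s : R) x : 0 < t ->
  log_density (t * r) (t * s) (t *: x) = t ^- d * log_density r s x.
Proof.
move=> t0; rewrite /log_density enormZ ?ltW// powRM ?enorm_ge0 ?ltW//.
rewrite powRN powR_mulrn ?ltW// -mulrA; congr (_ * (_ * _)).
rewrite !indicE !mem_annulus (enormZ _ (ltW t0)) ler_pM2l// ltr_pM2l//.
have -> // : (t *: x \in @Omega R d) = (x \in @Omega R d).
by apply/idP/idP; rewrite !inE => /(Omega_dilation _ t0).
Qed.

Lemma integral_log_density_dilation (t r s : R) : 0 < t ->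
  (\int[leb]_x (log_density (t * r) (t * s) x)%:E =
   \int[leb]_x (log_density r s x)%:E)%E.
Proof.
move=> t0.
have m1 a b : measurable_fun setT (EFin \o log_density a b).
  by apply/measurable_EFinP; exact: measurable_log_density.
have p1 a b x : (0 <= (EFin \o log_density a b) x)%E.
  by rewrite lee_fin; exact: log_density_ge0.
have td0 : t ^- d != 0 by rewrite invr_neq0// expf_neq0// gt_eqF.
have td : (0 <= (t ^- d)%:E)%E by rewrite lee_fin invr_ge0 exprn_ge0// ltW.
have := integral_lebesgue_rV_dilation t0 (m1 (t * r) (t * s)) (p1 _ _).
rewrite [in LHS](eq_integral (fun x => (t ^- d)%:E * (log_density r s x)%:E)%E); last first.
  by move=> x _; rewrite /= log_density_dilation// EFinM.
rewrite (ge0_integralZl _ measurableT (m1 r s) (fun x _ => p1 r s x) td) => /esym.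
move=> /(congr1 (mule ((t ^- d)^-1)%:E)).
by rewrite !muleA -EFinM mulVf// !mul1e.
Qed.

Lemma log_density_cat (r s t : R) x : r <= s -> s <= t ->
  log_density r t x = log_density r s x + log_density s t x.
Proof.
move=> rs st; rewrite /log_density -mulrDr; congr (_ * _); rewrite !indicE.
rewrite !mem_annulus; case: (x \in _); rewrite /= ?addr0//.
have [xs|sx] := ltP (enorm x) s.
  by rewrite (lt_le_trans xs st) andbT addr0.
by rewrite (le_trans rs sx) andbF add0r.
Qed.

Lemma integral_log_density_cat (r s t : R) : r <= s -> s <= t ->
  (\int[leb]_x (log_density r t x)%:E =
   \int[leb]_x (log_density r s x)%:E + \int[leb]_x (log_density s t x)%:E)%E.
Proof.
move=> rs st.
have m1 a b : measurable_fun setT (EFin \o log_density a b).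
  by apply/measurable_EFinP; exact: measurable_log_density.
have p1 a b x : (0 <= (EFin \o log_density a b) x)%E.
  by rewrite lee_fin; exact: log_density_ge0.
rewrite -(ge0_integralD _ measurableT (fun x _ => p1 r s x) (m1 r s)
  (fun x _ => p1 s t x) (m1 s t)).
by apply: eq_integral => x _; rewrite /= (log_density_cat _ rs st) EFinD.
Qed.

(** The annulus lies in a box, on which the density is at most [1], and contains
    the box of points whose coordinates lie between [d^(-1/2)] and
    [3/2 d^(-1/2)], whose points have norm between [1] and [3/2]. *)
Lemma integral_log_density_unit : exists2 sigma : R, 0 < sigma &
  (\int[leb]_x (log_density 1 2 x)%:E = sigma%:E)%E.
Proof.
have dn0 : (0 : R) < d%:R by rewrite ltr0n.
pose al : R := (Num.sqrt d%:R)^-1.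
have al0 : 0 < al by rewrite invr_gt0 sqrtr_gt0.
have al2 : al ^+ 2 = d%:R^-1 by rewrite exprVn sqr_sqrtr// ltW.
have m1 : measurable_fun setT (EFin \o log_density 1 2).
  by apply/measurable_EFinP; exact: measurable_log_density.
have p1 x : (0 <= (EFin \o log_density 1 2) x)%E.
  by rewrite lee_fin; exact: log_density_ge0.
have iB a b : (leb (rV_box a b) = \int[leb]_x (\1_(rV_box a b) x)%:E)%E.
  by rewrite integral_indic; [rewrite setIT|exact: measurableT|exact: measurable_rV_box].
have mI (a b : R) : measurable_fun setT (fun x => (\1_(@rV_box R d a b) x : R)%:E).
  by apply/measurable_EFinP; apply: measurable_indic; exact: measurable_rV_box.
have up : (\int[leb]_x (log_density 1 2 x)%:E <= ((2 - (- 2)) ^+ d)%:E)%E.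
  rewrite -lebesgue_rV_box; last by lra.
  rewrite iB.
  apply: ge0_le_integral; [exact: measurableT|by move=> x _; exact: p1|exact: m1|exact: mI|].
    move=> x _; rewrite lee_fin /log_density /= !indicE mem_annulus.
    case: (boolP (_ && _)) => [/andP[_ /andP[x1 x2]]|_]; last by rewrite mulr0.
    rewrite mem_set ?mulr1; last first.
      move=> i; have := le_lt_trans (coord_le_enorm x i) x2.
      by rewrite ltr_norml => /andP[/ltW -> ->].
    rewrite powRN powR_mulrn ?enorm_ge0// invf_le1 ?exprn_ege1// exprn_gt0//.
    exact: lt_le_trans x1.
have lo : (((2 ^- d) * (3 / 2 * al - al) ^+ d)%:E <= \int[leb]_x (log_density 1 2 x)%:E)%E.
  rewrite EFinM -lebesgue_rV_box; last by lra.
  rewrite iB.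
  have d2 : (0 <= (2 ^- d : R)%:E)%E by rewrite lee_fin invr_ge0 exprn_ge0.
  have I0 x : (0 <= (\1_(@rV_box R d al (3 / 2 * al)) x : R)%:E)%E by rewrite lee_fin.
  rewrite -(ge0_integralZl _ measurableT (mI _ _) (fun x _ => I0 x) d2).
  apply: (ge0_le_integral _ measurableT _ _ m1) => [x _||x _].
  - by rewrite -EFinM lee_fin mulr_ge0// invr_ge0 exprn_ge0.
  - by apply/measurable_EFinP; apply: measurable_funM => //; apply: measurable_indic;
      exact: measurable_rV_box.
  - rewrite /= -EFinM lee_fin /log_density !indicE.
    have [xB|_] := boolP (x \in rV_box _ _); last first.
      by rewrite mulr0 mulr_ge0 ?powR_ge0.
    move: xB; rewrite inE => xB.
    have x0 i : 0 < x ord0 i by have /andP[h _] := xB i; exact: lt_le_trans h.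
    have x1 : 1 <= enorm x.
      rewrite -(@ler_pXn2r _ 2%N) ?nnegrE ?enorm_ge0// expr1n sqr_enorm.
      apply: (@le_trans _ _ (\sum_(i < d) al ^+ 2)).
        by rewrite sumr_const card_ord al2 -[_ *+ _]mulr_natl divff// gt_eqF.
      apply: ler_sum => i _; have /andP[h _] := xB i.
      by rewrite ler_pXn2r ?nnegrE ?(ltW al0) ?(ltW (x0 i)).
    have x2 : enorm x < 2.
      rewrite -(@ltr_pXn2r _ 2%N) ?nnegrE ?enorm_ge0// sqr_enorm.
      apply: (@le_lt_trans _ _ (\sum_(i < d) (3 / 2 * al) ^+ 2)).
        apply: ler_sum => i _; have /andP[_ /ltW h] := xB i.
        by rewrite ler_pXn2r ?nnegrE ?(ltW (x0 i)) ?mulr_ge0 ?(ltW al0).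
      rewrite sumr_const card_ord -[_ *+ _]mulr_natl exprMn al2 mulrCA divff ?gt_eqF//.
      by rewrite mulr1; lra.
    rewrite mem_annulus x1 x2 andbT mem_set ?mulr1; last first.
      by rewrite /Omega; case: ifP.
    rewrite powRN powR_mulrn ?enorm_ge0// lef_pV2 ?posrE ?exprn_gt0//; last first.
      exact: lt_le_trans x1.
    by rewrite lerXn2r ?nnegrE ?enorm_ge0 ?(ltW x2).
have fin : (\int[leb]_x (log_density 1 2 x)%:E)%E \is a fin_num.
  rewrite ge0_fin_numE; first exact: le_lt_trans up (ltry _).
  by apply: integral_ge0 => x _; exact: p1.
exists (fine (\int[leb]_x (log_density 1 2 x)%:E)%E); last by rewrite fineK.
rewrite -lte_fin fineK//; apply: lt_le_trans lo.
rewrite lte_fin mulr_gt0 ?invr_gt0 ?exprn_gt0//; lra.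
Qed.

(** All dyadic annuli are dilates of the unit one, so they have the same mass. *)
Lemma integral_log_density_dyadic (sigma r : R) n : 0 < r ->
  (\int[leb]_x (log_density 1 2 x)%:E = sigma%:E)%E ->
  (\int[leb]_x (log_density r (2 ^+ n * r) x)%:E = (n%:R * sigma)%:E)%E.
Proof.
move=> r0 sE; elim: n => [|n IH].
  rewrite mul0r expr0 mul1r -[RHS](integral0 leb setT).
  apply: eq_integral => x _; rewrite /log_density indicE mem_annulus.
  by case: (leP r (enorm x)) => h; rewrite ?andbF ?(ltNge (enorm x) r) ?h ?andbF mulr0.
have rr : 0 < 2 ^+ n * r by rewrite mulr_gt0 ?exprn_gt0.
have -> : 2 ^+ n.+1 * r = 2 ^+ n * r * 2 by rewrite exprS; ring.
have sd := integral_log_density_dilation 1 2 rr; rewrite mulr1 in sd.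
rewrite (@integral_log_density_cat r (2 ^+ n * r)).
- by rewrite IH sd sE -EFinD -addn1 natrD mulrDl mul1r.
- by rewrite ler_peMl ?(ltW r0)// exprn_ege1// ler1n.
- by rewrite ler_peMr ?(ltW rr)// ler1n.
Qed.

End annuli.

(** * Near-extremal test functions *)

Section test_functions.
Context {R : realType} (d : nat).
Hypothesis d_gt0 : (0 < d)%N.
Variables (p beta : R) (S S' : R -> R) (L : R).
Hypotheses (p1 : 1 < p) (CS : cinf S) (dS : forall t : R, is_derive t 1 S (S' t)).
Hypotheses (S01 : forall t, 0 <= S t <= 1).
Hypotheses (S_le0 : forall t, t <= 0 -> S t = 0) (S_ge1 : forall t, 1 <= t -> S t = 1).
Hypotheses (S'_out : forall t, t <= 0 \/ 1 <= t -> S' t = 0).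
Hypotheses (L0 : 0 <= L) (S'_le : forall t, `|S' t| <= L).
Variables (a b : R).
Hypotheses (a0 : 0 < a) (ab : 2 * a <= b).

Local Notation g := (d%:R - (p + beta)).
Local Notation C := (hardy_constant d p beta).
Local Notation q x := (\sum_i x ord0 i ^+ 2).

Let b0 : 0 < b. Proof. by apply: lt_le_trans ab; rewrite mulr_gt0. Qed.
Let p0 : 0 < p. Proof. exact: lt_trans p1. Qed.

(** As a function of the squared norm, it goes from [0] to [1] while the norm goes
    from [c] to [2 c]. *)
Definition shell_arg (c r : R) : R := (3 * c ^+ 2)^-1 * r + - 3^-1.

(** A cutoff in the squared norm, equal to [1] for norms between [2 a] and [b] and to
    [0] for norms below [a] or above [2 b]. *)
Definition shell (r : R) : R :=
  S (shell_arg a r) * (1 + -1 * S (shell_arg b r)).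

Definition shell' (r : R) : R :=
  S (shell_arg a r) * (-1 * (S' (shell_arg b r) * (3 * b ^+ 2)^-1)) +
  (1 + -1 * S (shell_arg b r)) * (S' (shell_arg a r) * (3 * a ^+ 2)^-1).

Lemma shell_arg_le0 c r : 0 < c -> (shell_arg c r <= 0) = (r <= c ^+ 2).
Proof.
move=> c0; have c20 : 0 < 3 * c ^+ 2 by rewrite mulr_gt0 ?exprn_gt0.
rewrite /shell_arg subr_le0 ler_pdivrMl//; congr (_ <= _).
by field.
Qed.

Lemma shell_arg_ge1 c r : 0 < c -> (1 <= shell_arg c r) = ((2 * c) ^+ 2 <= r).
Proof.
move=> c0; have c20 : 0 < 3 * c ^+ 2 by rewrite mulr_gt0 ?exprn_gt0.
rewrite /shell_arg lerBrDr ler_pdivlMl//; congr (_ <= _).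
by field.
Qed.

Lemma cinf_shell_arg c : cinf (shell_arg c).
Proof.
apply: cinf_add; last exact: cinf_cst.
by apply: cinf_mul; [exact: cinf_cst|exact: cinf_id].
Qed.

Lemma cinf_shell : cinf shell.
Proof.
apply: cinf_mul; first exact: cinf_comp CS (cinf_shell_arg a).
apply: cinf_add; first exact: cinf_cst.
by apply: cinf_mul; [exact: cinf_cst|exact: cinf_comp CS (cinf_shell_arg b)].
Qed.

Lemma is_derive_shell (r : R) : is_derive r 1 shell (shell' r).
Proof.
have Darg c : is_derive r 1 (shell_arg c) (3 * c ^+ 2)^-1.
  have D := is_deriveD (is_deriveM (is_derive_cst ((3 * c ^+ 2)^-1 : R) r (1 : R))
    (is_derive_id r (1 : R)))
    (is_derive_cst (- 3^-1 : R) r (1 : R)).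
  by apply: (is_derive_eq D); rewrite /GRing.scale/= mulr1 mulr0 !addr0.
have DS c : is_derive r 1 (fun r => S (shell_arg c r)) (S' (shell_arg c r) * (3 * c ^+ 2)^-1).
  exact: (is_derive1_comp (dS (shell_arg c r)) (Darg c)).
have D1 := is_deriveD (is_derive_cst (1 : R) r (1 : R))
  (is_deriveM (is_derive_cst (-1 : R) r (1 : R)) (DS b)).
apply: (is_derive_eq (is_deriveM (DS a) D1)).
by rewrite /GRing.scale/= /shell' mulr0 addr0 add0r.
Qed.

Lemma shell_range r : 0 <= shell r <= 1.
Proof.
have /andP[h1 h2] := S01 (shell_arg a r); have /andP[h3 h4] := S01 (shell_arg b r).
rewrite /shell mulN1r; apply/andP; split; first by rewrite mulr_ge0// subr_ge0.
by rewrite -[leRHS]mulr1 ler_pM// ?subr_ge0// gerBl.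
Qed.

Lemma shell_inner r : r <= a ^+ 2 -> shell r = 0.
Proof. by move=> ra; rewrite /shell (S_le0 (t := shell_arg a r)) ?mul0r// shell_arg_le0. Qed.

Lemma shell_outer r : (2 * b) ^+ 2 <= r -> shell r = 0 /\ shell' r = 0.
Proof.
move=> br; have h : 1 <= shell_arg b r by rewrite shell_arg_ge1.
rewrite /shell /shell' (S_ge1 h) mulN1r subrr mulr0 mul0r addr0; split=> //.
by rewrite S'_out ?mul0r ?mulr0//; right.
Qed.

Lemma shell_plateau r : (2 * a) ^+ 2 <= r <= b ^+ 2 -> shell r = 1 /\ shell' r = 0.
Proof.
move=> /andP[ar rb]; have h : 1 <= shell_arg a r by rewrite shell_arg_ge1.
have h' : shell_arg b r <= 0 by rewrite shell_arg_le0.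
rewrite /shell /shell' (S_ge1 h) (S_le0 h') mulr0 addr0 mul1r; split=> //.
by rewrite (S'_out (or_introl h')) (S'_out (or_intror h)) !mul0r !mulr0 addr0.
Qed.

Lemma shell'_inner r : r <= a ^+ 2 -> shell' r = 0.
Proof.
move=> ra; have h : shell_arg a r <= 0 by rewrite shell_arg_le0.
by rewrite /shell' (S_le0 h) (S'_out (or_introl h)) mul0r !mul0r mulr0 addr0.
Qed.

(** Both transitions have the same length on a logarithmic scale, so the
    dilation-invariant derivative is bounded independently of [a] and [b]. *)
Lemma shell'_bound r : 0 <= r -> `|2 * r * shell' r| <= 4 * L.
Proof.
move=> r0.
have K c : 0 < c -> `|2 * r * (S' (shell_arg c r) * (3 * c ^+ 2)^-1)| <= 4 * L.
  move=> c0; have [cr|rc] := leP ((2 * c) ^+ 2) r.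
    rewrite S'_out ?mul0r ?mulr0 ?normr0 ?mulr_ge0//.
    by right; rewrite shell_arg_ge1.
  have c20 : 0 < 3 * c ^+ 2 by rewrite mulr_gt0 ?exprn_gt0.
  rewrite (_ : 2 * r * _ = (2 * r / (3 * c ^+ 2)) * S' (shell_arg c r)); last by ring.
  rewrite normrM ler_pM// normf_div !ger0_norm ?mulr_ge0 ?(ltW c20) ?(ltW c0)//.
  rewrite ler_pdivrMr//; move: rc; rewrite exprMn; lra.
have [ra|ar] := leP r ((2 * a) ^+ 2).
  have h : shell_arg b r <= 0.
    rewrite shell_arg_le0// (le_trans ra)// ler_pXn2r ?nnegrE ?(ltW b0)//.
    by rewrite mulr_ge0// ltW.
  by rewrite /shell' (S_le0 h) (S'_out (or_introl h)) mul0r !mulr0 add0r addr0 mul1r K.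
have h : 1 <= shell_arg a r by rewrite shell_arg_ge1// ltW.
rewrite /shell' (S_ge1 h) (S'_out (or_intror h)) mul1r mul0r mulr0 addr0.
by rewrite mulN1r mulrN normrN K.
Qed.

Local Notation e := (- (g / (2 * p))).

(** The cutoff of [|x|^(- (d - (p + beta)) / p)], for which Hardy's inequality is
    formally an equality, as a function of the squared norm. *)
Definition profile (r : R) : R := shell r * r `^ e.

Definition profile' (r : R) : R := shell r * (e * r `^ (e - 1)) + r `^ e * shell' r.

Lemma cinf_profile : cinf profile.
Proof.
apply: (cinf_cut_powR (a := a ^+ 2)); first exact: cinf_shell.
  by rewrite exprn_gt0.
by move=> t /ltW; exact: shell_inner.
Qed.

Lemma is_derive_profile (r : R) : 0 < r -> is_derive r 1 profile (profile' r).
Proof.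
by move=> r0; exact: (is_deriveM (is_derive_shell r) (is_derive1_powR e r0)).
Qed.

Let i0 : 'I_d := Ordinal d_gt0.

Lemma ord_dim1 (i : 'I_d) : d = 1%N -> i = i0.
Proof.
move=> d1; apply/val_inj; move: (ltn_ord i); rewrite [in X in (_ < X)%N]d1 /=.
by case: (val i).
Qed.

(** In dimension one the test function must vanish on the negative half-line. *)
Definition half_line_cutoff : 'rV[R]_d -> R :=
  if d == 1%N then fun x => S (2 / a * x ord0 i0) else fun=> 1.

Lemma half_line_cutoffE x : d = 1%N -> half_line_cutoff x = S (2 / a * x ord0 i0).
Proof. by rewrite /half_line_cutoff; case: eqP. Qed.

Definition hardy_test (x : 'rV[R]_d) : R := profile (q x) * half_line_cutoff x.

Lemma hardy_test_smooth : smooth hardy_test.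
Proof.
apply: cinf_rV_smooth; apply: cinf_rV_mul.
  exact: (cinf_rV_comp cinf_profile cinf_rV_sqr_norm).
rewrite /half_line_cutoff; case: ifP => _; last exact: cinf_rV_cst.
apply: cinf_rV_comp => //; apply: cinf_rV_mul; first exact: cinf_rV_cst.
exact: cinf_rV_coord.
Qed.

(** A compact set containing the support and contained in the allowed open set. *)
Definition closed_shell : set 'rV[R]_d :=
  [set x | a <= enorm x <= 2 * b /\ (d = 1%N -> 0 <= x ord0 i0)].

Lemma hardy_test_support : [set x | hardy_test x != 0] `<=` closed_shell.
Proof.
move=> x /=; rewrite /hardy_test mulf_eq0 negb_or => /andP[qx tx]; split.
  apply/andP; split.
    rewrite leNgt; apply: contra qx => xa.
    rewrite /profile shell_inner ?mul0r// -sqr_enorm.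
    by rewrite ler_pXn2r ?nnegrE ?enorm_ge0 ?(ltW a0) ?(ltW xa).
  rewrite leNgt; apply: contra qx => xb.
  rewrite /profile (shell_outer _).1 ?mul0r// -sqr_enorm.
  by rewrite ler_pXn2r ?nnegrE ?enorm_ge0 ?mulr_ge0 ?(ltW b0) ?(ltW xb).
move=> d1; move: tx; rewrite half_line_cutoffE// => tx.
rewrite leNgt; apply: contra tx => x0.
by rewrite S_le0// mulr_ge0_le0 ?divr_ge0 ?(ltW a0) ?(ltW x0).
Qed.

Lemma continuous_enorm : continuous (@enorm R d).
Proof.
move=> x; apply: (@continuous_comp _ _ _ (fun y : 'rV[R]_d => q y) Num.sqrt x).
  exact: (cinf_rV_continuous cinf_rV_sqr_norm).
exact: sqrt_continuous.
Qed.

Lemma closed_closed_shell : closed closed_shell.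
Proof.
rewrite (_ : closed_shell = (@enorm R d) @^-1` `[a, 2 * b]%classic `&`
   [set x : 'rV[R]_d | d = 1%N -> 0 <= x ord0 i0]).
  apply: closedI.
    apply: closed_comp => [x _|]; first exact: continuous_enorm.
    exact: interval_closed.
  case: (eqVneq d 1%N) => [d1|d1].
    rewrite (_ : [set x | _] = (fun x : 'rV[R]_d => x ord0 i0) @^-1` [set y | 0 <= y]).
      apply: closed_comp => [x _|]; first exact: coord_continuous.
      exact: closed_ge.
    by apply/seteqP; split=> x /= h; [exact: h|move=> _].
  rewrite (_ : [set x | _] = setT); first exact: closedT.
  by apply/seteqP; split=> x //= _ d1'; rewrite d1' eqxx in d1.
by apply/seteqP; split=> x /=; rewrite in_itv.
Qed.

Lemma closure_hardy_test : closure [set x | hardy_test x != 0] `<=` closed_shell.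
Proof.
rewrite [X in _ `<=` X]((closure_id _).1 closed_closed_shell).
exact/closure_subset/hardy_test_support.
Qed.

Lemma compact_closure_hardy_test : compact (closure [set x | hardy_test x != 0]).
Proof.
apply: bounded_closed_compact; last exact: closed_closure.
exists (2 * b); split; first exact: num_real.
move=> M bM x /closure_hardy_test [/andP[_ xb] _].
suff: `|x| <= M by [].
rewrite [leLHS]/Num.norm/= mx_normrE; apply: bigmax_le => [|[i j] _ /=].
  by rewrite (le_trans _ (ltW bM))// mulr_ge0 ?(ltW b0).
rewrite ord1 (le_trans (coord_le_enorm _ _))// (le_trans xb)// ltW//.
Qed.

Lemma closed_shell_neq0 x : closed_shell x -> x != 0.
Proof.
have e0 : enorm (0 : 'rV[R]_d) = 0 by rewrite -(scale0r 0) enormZ// mul0r.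
by move=> [/andP[xa _] _]; apply: contraTneq xa => ->; rewrite e0 -ltNge.
Qed.

Lemma hardy_test_Cc0 : Cc0 hardy_test.
Proof.
split; [exact: hardy_test_smooth|exact: compact_closure_hardy_test|].
move=> x /closure_hardy_test cx; have xn0 := closed_shell_neq0 cx.
case: ifPn => [/eqP d1|_]; last by move=> /= x0; rewrite x0 eqxx in xn0.
move=> i; have [_ /(_ d1) x0] := cx; rewrite (ord_dim1 i d1) lt_def x0 andbT.
apply: contra_neq xn0 => xi0; apply/rowP => j.
by rewrite mxE (ord_dim1 j d1).
Qed.

Lemma hardy_test_Omega x : Omega x -> hardy_test x = profile (q x).
Proof.
rewrite /hardy_test; case: (eqVneq d 1%N) => [d1 Ox|d1 _]; last first.
  by rewrite /half_line_cutoff (negbTE d1) mulr1.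
have x0 : 0 < x ord0 i0.
  by move: Ox; rewrite /Omega; case: eqP => // _ h; exact: h.
have [xa|ax] := leP (enorm x) a.
  rewrite /profile shell_inner ?mul0r// -sqr_enorm.
  by rewrite ler_pXn2r ?nnegrE ?enorm_ge0 ?(ltW a0).
rewrite half_line_cutoffE// S_ge1 ?mulr1//.
have ex : enorm x = x ord0 i0.
  apply/eqP; rewrite -(@eqrXn2 _ 2%N) ?enorm_ge0 ?(ltW x0)// sqr_enorm (bigD1 i0)//=.
  rewrite big1 ?addr0// => j; rewrite (ord_dim1 j d1) eqxx//.
rewrite -ex mulrAC ler_pdivlMr// mul1r; have := enorm_ge0 x; lra.
Qed.

Lemma open_Omega : open (@Omega R d).
Proof.
case: (eqVneq d 1%N) => [d1|d1]; last by rewrite /Omega (negbTE d1); exact: openT.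
rewrite (_ : @Omega R d = (fun x : 'rV[R]_d => x ord0 i0) @^-1` [set y | 0 < y]).
  apply: open_comp => [x _|]; first exact: coord_continuous.
  exact: open_gt.
rewrite /Omega; case: eqP => // _; apply/seteqP; split=> x /= h; first exact: h.
by move=> i; rewrite (ord_dim1 i d1).
Qed.

Lemma q_gt0 (x : 'rV[R]_d) : x != 0 -> 0 < q x.
Proof.
by move=> xn0; rewrite -sqr_enorm exprn_gt0// enorm_gt0.
Qed.

Lemma grad_hardy_test x : Omega x -> x != 0 ->
  grad hardy_test x = (2 * profile' (q x)) *: x.
Proof.
move=> Ox xn0; apply/rowP => i; rewrite !mxE.
have D := is_derive_comp_along (is_derive_profile (q_gt0 xn0)) (is_derive_sqr_norm x i).
have near_x : \forall y \near x, profile (q (y : 'rV[R]_d)) = hardy_test y.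
  have : nbhs x (@Omega R d) by apply: open_nbhs_nbhs; split => //; exact: open_Omega.
  by apply: filterS => y Oy; rewrite hardy_test_Omega.
rewrite /partial; have [_ ->] := near_eq_is_derive near_x D; ring.
Qed.

Lemma enorm_grad_hardy_test x : Omega x -> x != 0 ->
  enorm (grad hardy_test x) = `|2 * profile' (q x)| * enorm x.
Proof.
move=> Ox xn0; rewrite grad_hardy_test//; set t := 2 * _.
apply/eqP; rewrite -(@eqrXn2 _ 2%N) ?mulr_ge0 ?enorm_ge0//.
rewrite exprMn !sqr_enorm real_normK ?num_real// mulr_sumr.
by apply/eqP/eq_bigr => i _; rewrite mxE exprMn.
Qed.

Let sqr_powR (r y : R) : 0 <= r -> (r ^+ 2) `^ y = r `^ (2 * y).
Proof. by move=> r0; rewrite -powR_mulrn// -powRrM. Qed.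

Let powRD' (r y z : R) : 0 < r -> r `^ y * r `^ z = r `^ (y + z).
Proof. by move=> r0; rewrite powRD//; apply/implyP => _; rewrite gt_eqF. Qed.

(** The exponents add up to [- d], whence the invariant density. *)
Lemma hardy_test_power x : Omega x -> x != 0 ->
  `|hardy_test x| `^ p * enorm x `^ (- (p + beta)) =
  enorm x `^ (- d%:R) * shell (q x) `^ p.
Proof.
move=> Ox xn0; have r0 := enorm_gt0 xn0.
rewrite hardy_test_Omega// /profile -sqr_enorm; set r := enorm x in r0 *.
have /andP[sh0 _] := shell_range (r ^+ 2).
have pr0 : 0 <= shell (r ^+ 2) * (r ^+ 2) `^ e by rewrite mulr_ge0 ?powR_ge0.
rewrite (ger0_norm pr0) (powRM _ sh0 (powR_ge0 _ _)).
rewrite (sqr_powR _ (ltW r0)) -powRrM -mulrA powRD'// mulrC.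
congr (_ `^ _ * _); field; exact: lt0r_neq0.
Qed.

(** The same cancellation for the gradient: on the plateau of the cutoff what
    remains of the second factor is the [p]-th power of the Hardy constant. *)
Lemma hardy_test_gradient x : Omega x -> x != 0 ->
  enorm (grad hardy_test x) `^ p * enorm x `^ (- beta) =
  enorm x `^ (- d%:R) *
    `|2 * q x * shell' (q x) - g / p * shell (q x)| `^ p.
Proof.
move=> Ox xn0; have r0 := enorm_gt0 xn0.
rewrite enorm_grad_hardy_test// /profile' -sqr_enorm; set r := enorm x in r0 *.
set s := shell _; set s' := shell' _.
have E : (r ^+ 2) `^ e = r ^+ 2 * (r ^+ 2) `^ (e - 1).
  rewrite -{2}[r ^+ 2]powRr1 ?sqr_ge0// powRD' ?exprn_gt0//; congr (_ `^ _); ring.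
rewrite E (_ : 2 * _ = (r ^+ 2) `^ (e - 1) * (2 * r ^+ 2 * s' - g / p * s)); last first.
  by field; exact: lt0r_neq0.
set D := 2 * r ^+ 2 * s' - _.
rewrite normrM (ger0_norm (powR_ge0 _ _)) mulrAC (sqr_powR _ (ltW r0)).
rewrite -{2}[r]powRr1 ?(ltW r0)// powRD'// powRM ?powR_ge0// -powRrM mulrAC powRD'//.
congr (_ `^ _ * _); field; exact: lt0r_neq0.
Qed.

Let sqr_le (r s : R) : 0 <= r -> 0 <= s -> (r ^+ 2 <= s ^+ 2) = (r <= s).
Proof. by move=> r0 s0; rewrite ler_pXn2r. Qed.

Lemma hardy_test_power_ge x : x != 0 -> Omega x ->
  log_density (2 * a) b x <= `|hardy_test x| `^ p * enorm x `^ (- (p + beta)).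
Proof.
move=> xn0 Ox; rewrite hardy_test_power// /log_density ler_wpM2l ?powR_ge0//.
rewrite indicE mem_annulus; case: (boolP (_ && _)) => [/andP[_ /andP[x1 x2]]|_]; last first.
  exact: powR_ge0.
have [->//] : shell (q x) = 1 /\ shell' (q x) = 0.
  apply: shell_plateau; rewrite -sqr_enorm !sqr_le ?enorm_ge0 ?mulr_ge0 ?(ltW a0) ?(ltW b0)//.
  by rewrite x1 ltW.
by rewrite powR1.
Qed.

Lemma hardy_test_power_le x : x != 0 -> Omega x ->
  `|hardy_test x| `^ p * enorm x `^ (- (p + beta)) <= log_density a (2 * b) x.
Proof.
move=> xn0 Ox; rewrite hardy_test_power// /log_density ler_wpM2l ?powR_ge0//.
rewrite indicE mem_annulus mem_set//=.
have /andP[s0 s1] := shell_range (q x).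
have [ax|xa] := leP a (enorm x) => /=; last first.
  rewrite shell_inner ?powR0 ?lt0r_neq0// -sqr_enorm sqr_le ?enorm_ge0 ?(ltW a0)//.
  exact: ltW.
have [bx|xb] := leP (2 * b) (enorm x) => /=; last first.
  have -> : 1%:R = 1 `^ p :> R by rewrite powR1.
  by apply: ge0_ler_powR; rewrite ?nnegrE ?(ltW p0).
rewrite (shell_outer _).1 ?powR0 ?lt0r_neq0// -sqr_enorm.
by rewrite sqr_le ?enorm_ge0 ?mulr_ge0 ?(ltW b0).
Qed.

(** The optimal constant on the plateau, and a worse one, independent of [a] and
    [b], on the two transition annuli. *)
Lemma hardy_test_gradient_le x : x != 0 -> Omega x ->
  enorm (grad hardy_test x) `^ p * enorm x `^ (- beta) <=
  (4 * L + C) `^ p * log_density a (2 * a) x + C `^ p * log_density (2 * a) b x +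
  (4 * L + C) `^ p * log_density b (2 * b) x.
Proof.
move=> xn0 Ox; rewrite hardy_test_gradient//.
have C0 : 0 <= C by rewrite divr_ge0 ?(ltW p0).
have qx0 := ltW (q_gt0 xn0).
have /andP[s0 s1] := shell_range (q x).
have gC : `|g / p * shell (q x)| <= C.
  rewrite normrM (ger0_norm s0) normf_div (gtr0_norm p0) -[leRHS]mulr1.
  by rewrite ler_wpM2l.
have K : `|2 * q x * shell' (q x) - g / p * shell (q x)| `^ p <= (4 * L + C) `^ p.
  apply: ge0_ler_powR; [exact: ltW|exact: normr_ge0|by rewrite nnegrE (addr_ge0 _ C0)// mulr_ge0|].
  by apply: le_trans (ler_normB _ _) _; apply: lerD => //; exact: shell'_bound.
have W0 := powR_ge0 (enorm x) (- d%:R).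
rewrite /log_density.
rewrite (_ : _ + _ + _ = enorm x `^ (- d%:R) *
   ((4 * L + C) `^ p * \1_(annulus a (2 * a)) x + C `^ p * \1_(annulus (2 * a) b) x
    + (4 * L + C) `^ p * \1_(annulus b (2 * b)) x)); last by ring.
apply: ler_wpM2l => //; rewrite !indicE !mem_annulus mem_set//=.
have := enorm_ge0 x; set r := enorm x => r0.
have q2 : q x = r ^+ 2 by rewrite sqr_enorm.
have le2 s : 0 <= s -> (s ^+ 2 <= q x) = (s <= r) by move=> ?; rewrite q2 sqr_le.
have le2' s : 0 <= s -> (q x <= s ^+ 2) = (r <= s) by move=> ?; rewrite q2 sqr_le.
have a2 : 0 <= 2 * a by rewrite mulr_ge0 ?(ltW a0).
have b2 : 0 <= 2 * b by rewrite mulr_ge0 ?(ltW b0).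
have zero : 0 = `|0 : R| `^ p by rewrite normr0 powR0 ?lt0r_neq0.
have [ra|ar] := ltP r a.
  rewrite shell_inner ?shell'_inner ?le2' ?(ltW a0) ?(ltW ra)//.
  by rewrite !mulr0 subr0 -zero !addr_ge0 ?mulr_ge0 ?powR_ge0.
have [ra2|ar2] := ltP r (2 * a).
  rewrite mulr1 (le_trans K)// -addrA lerDl addr_ge0 ?mulr_ge0 ?powR_ge0//.
have [rb|br] := ltP r b.
  have [-> ->] : shell (q x) = 1 /\ shell' (q x) = 0.
    by apply: shell_plateau; rewrite le2// le2' ?(ltW b0)// ar2 ltW.
  rewrite !mulr0 mulr1 sub0r normrN normf_div (gtr0_norm p0) -/C.
  by rewrite /= mulr1 add0r addr0.
have [rb2|br2] := ltP r (2 * b).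
  by rewrite /= !mulr0 mulr1 !add0r.
have [-> ->] : shell (q x) = 0 /\ shell' (q x) = 0 by apply: shell_outer; rewrite le2.
by rewrite !mulr0 subr0 -zero !addr_ge0 ?mulr_ge0 ?powR_ge0.
Qed.

End test_functions.

(** * Optimality of the constant *)

Section optimality.
Context {R : realType} (d : nat).
Hypothesis d_gt0 : (0 < d)%N.

Lemma Cc0_support (u : 'rV[R]_d -> R) : Cc0 u ->
  [/\ smooth u, compact (closure [set x | u x != 0]),
      closure [set x | u x != 0] `<=` @Omega R d &
      ~ closure [set x | u x != 0] 0].
Proof.
move=> [su cK KU]; split=> //; move: KU; rewrite /Omega; case: ifP => // _ KU.
  by move=> /KU /(_ (Ordinal d_gt0)); rewrite mxE ltxx.
by move=> /KU; apply.
Qed.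

Variables (p c beta : R) (A : 'M[R]_d).
Hypotheses (p1 : 1 < p) (c0 : 0 < c) (A0 : forall x, 0 <= quad A x).
Local Notation C := (hardy_constant d p beta).
Local Notation leb := (lebesgue_rV d).

Let p0 : 0 < p. Proof. exact: lt_trans p1. Qed.
Let C0 : 0 <= C. Proof. by rewrite divr_ge0 ?(ltW p0). Qed.

(** From [1 + t <= expR t] and [1 <= p]. *)
Lemma rho_ge (eps : R) x : quad A x `^ (p / 2) <= eps ->
  c * (1 - eps) <= rho p c A x.
Proof.
move=> xe; rewrite /rho ler_wpM2l ?(ltW c0)//.
apply: le_trans (expR_ge1Dx _); rewrite lerD2l lerN2 (le_trans _ xe)//.
by rewrite ler_piMl ?powR_ge0// invf_le1 ?(ltW p1).
Qed.

Lemma quad_small_near0 (eps : R) : 0 < eps ->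
  exists2 b, 0 < b & forall x : 'rV[R]_d, enorm x <= 2 * b -> quad A x `^ (p / 2) <= eps.
Proof.
move=> e0; set N := \sum_i \sum_j `|A j i|.
have N0 : 0 <= N by rewrite sumr_ge0// => i _; rewrite sumr_ge0.
have N1 : 0 < N + 1 by rewrite ltr_wpDl.
pose b2 := eps `^ (2 / p) / (N + 1).
have b20 : 0 < b2 by rewrite divr_gt0 ?powR_gt0.
exists (Num.sqrt b2 / 2); first by rewrite divr_gt0 ?sqrtr_gt0.
move=> x; rewrite mulrC divfK// => xb.
have xb2 : enorm x ^+ 2 <= b2.
  by rewrite -(sqr_sqrtr (ltW b20)) ler_pXn2r ?nnegrE ?enorm_ge0 ?sqrtr_ge0.
have -> : eps = (eps `^ (2 / p)) `^ (p / 2).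
  rewrite -powRrM (_ : 2 / p * (p / 2) = 1) ?powRr1 ?(ltW e0)//.
  by field; exact: lt0r_neq0.
apply: ge0_ler_powR; rewrite ?nnegrE ?powR_ge0 ?divr_ge0 ?(ltW p0)//.
rewrite (le_trans (ler_norm _))// (le_trans (quad_le_enorm _ _))// -/N.
apply: (@le_trans _ _ ((N + 1) * b2)).
  by rewrite ler_pM ?sqr_ge0// lerDl.
by rewrite /b2 mulrC divfK// lt0r_neq0.
Qed.

Section fixed_scale.
Variables (S S' : R -> R) (L : R).
Hypotheses (CS : cinf S) (dS : forall t : R, is_derive t 1 S (S' t)).
Hypotheses (S01 : forall t, 0 <= S t <= 1).
Hypotheses (S_le0 : forall t, t <= 0 -> S t = 0) (S_ge1 : forall t, 1 <= t -> S t = 1).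
Hypotheses (S'_out : forall t, t <= 0 \/ 1 <= t -> S' t = 0).
Hypotheses (L0 : 0 <= L) (S'_le : forall t, `|S' t| <= L).
Variables (a b eps lambda sigma : R) (n : nat).
Hypotheses (a0 : 0 < a) (bE : b = 2 ^+ n * (2 * a)).
Hypotheses (eps0 : 0 <= eps <= 1) (lambda0 : 0 <= lambda).
Hypothesis quad_eps : forall x : 'rV[R]_d, enorm x <= 2 * b -> quad A x `^ (p / 2) <= eps.
Hypotheses (sigma0 : 0 < sigma)
  (sigmaE : (\int[leb]_x (log_density 1 2 x)%:E = sigma%:E)%E).

Local Notation u := (hardy_test d_gt0 p beta S a b).
Local Notation F := (weighted_power p c beta A u).

Let ab : 2 * a <= b.
Proof. by rewrite bE ler_peMl ?mulr_ge0 ?(ltW a0)// exprn_ege1// ler1n. Qed.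

Let a20 : 0 < 2 * a. Proof. by rewrite mulr_gt0. Qed.
Let b0 : 0 < b. Proof. exact: lt_le_trans ab. Qed.

Let uC : Cc0 u.
Proof. exact: hardy_test_Cc0. Qed.

Let integral_scaled (k r s m : R) : 0 <= k ->
  (\int[leb]_x (log_density r s x)%:E = m%:E)%E ->
  (\int[leb]_x (k * log_density r s x)%:E = (k * m)%:E)%E.
Proof.
move=> k0 mE.
have mf : measurable_fun setT (fun x : 'rV[R]_d => (log_density r s x)%:E).
  by apply/measurable_EFinP; exact: measurable_log_density.
have f0 (x : 'rV[R]_d) : (0 <= (log_density r s x)%:E :> \bar R)%E.
  by rewrite lee_fin; exact: log_density_ge0.
have k0' : (0 <= k%:E)%E by rewrite lee_fin.
transitivity (\int[leb]_x (k%:E * (log_density r s x)%:E))%E.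
  by apply: eq_integral => x _; rewrite EFinM.
by rewrite (ge0_integralZl _ measurableT mf (fun x _ => f0 x) k0') mE.
Qed.

Let mass_middle : (\int[leb]_x (log_density (2 * a) b x)%:E = (n%:R * sigma)%:E)%E.
Proof. by rewrite bE; exact: integral_log_density_dyadic. Qed.

Let mass_double (r : R) : 0 < r ->
  (\int[leb]_x (log_density r (2 * r) x)%:E = sigma%:E)%E.
Proof. by move=> r0; have := integral_log_density_dyadic 1 r0 sigmaE; rewrite expr1 mul1r. Qed.

Let mass_total : (\int[leb]_x (log_density a (2 * b) x)%:E = (n.+2%:R * sigma)%:E)%E.
Proof.
rewrite (_ : 2 * b = 2 ^+ n.+2 * a); first exact: integral_log_density_dyadic.
by rewrite bE !exprS; ring.
Qed.

Let measurable_scaled (k r s : R) :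
  measurable_fun setT (fun x : 'rV[R]_d => (k * log_density r s x)%:E).
Proof.
apply/measurable_EFinP; apply: measurable_funM; first exact: measurable_cst.
exact: measurable_log_density.
Qed.

Let scaled_ge0 (k r s : R) (x : 'rV[R]_d) : 0 <= k -> (0 <= (k * log_density r s x)%:E)%E.
Proof. by move=> k0; rewrite lee_fin mulr_ge0//; exact: log_density_ge0. Qed.

Let F_ge0 x : 0 <= F x.
Proof. by rewrite mulr_ge0 ?powR_ge0//; exact: weight_ge0. Qed.

Let F_ge x : c * (1 - eps) * log_density (2 * a) b x <= F x.
Proof.
have [xann|xann] := boolP (x \in annulus (2 * a) b); last first.
  by rewrite /log_density indicE (negbTE xann) !mulr0.
move: (xann); rewrite mem_annulus => /andP[/set_mem Ox /andP[xa xb]].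
have xn0 : x != 0.
  apply: contraTneq xa => ->; rewrite -ltNge.
  by rewrite (_ : enorm 0 = 0)// -(scale0r 0) enormZ// mul0r.
rewrite /weighted_power /weight mulrA mulrC.
apply: ler_pM.
- exact: log_density_ge0.
- by rewrite mulr_ge0 ?(ltW c0)// subr_ge0; have /andP[] := eps0.
- exact: hardy_test_power_ge.
- apply: rho_ge; apply: quad_eps; rewrite (le_trans (ltW xb))//.
  by rewrite ler_peMl ?(ltW b0)// ler1n.
Qed.

Let in_support x : closure [set x | u x != 0] x ->
  [/\ Omega x, x != 0 & enorm x <= 2 * b].
Proof.
move=> Kx; have [_ _ KO _] := Cc0_support uC.
have cx := closure_hardy_test S_le0 S_ge1 S'_out a0 ab Kx.
by split; [exact: KO|exact: (@closed_shell_neq0 _ _ d_gt0 _ _ a0 _ cx)|have [/andP[]] := cx].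
Qed.

Let F_le x : F x <= c * log_density a (2 * b) x.
Proof.
have [Kx|Kx] := pselect (closure [set x | u x != 0] x); last first.
  by rewrite weighted_power_off// mulr_ge0 ?(ltW c0)//; exact: log_density_ge0.
have [Ox xn0 xb] := in_support Kx.
rewrite /weighted_power /weight mulrA mulrC; apply: ler_pM; last exact: hardy_test_power_le.
- exact/rho_ge0/ltW.
- by rewrite mulr_ge0 ?powR_ge0.
- exact: rho_le.
Qed.

Let quad_density_le x : quad_density p c beta A u x <= eps * c * log_density a (2 * b) x.
Proof.
have e0 : 0 <= eps by have /andP[] := eps0.
have [Kx|Kx] := pselect (closure [set x | u x != 0] x); last first.
  rewrite /quad_density weighted_power_off// mulr0 mulr_ge0 ?log_density_ge0//.
  by rewrite mulr_ge0// ltW.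
have [Ox xn0 xb] := in_support Kx.
rewrite /quad_density -mulrA; apply: ler_pM; rewrite ?powR_ge0//.
exact: quad_eps.
Qed.

Let gradient_density_le x : gradient_density p c beta A u x <=
  c * (4 * L + C) `^ p * log_density a (2 * a) x + c * C `^ p * log_density (2 * a) b x +
  c * (4 * L + C) `^ p * log_density b (2 * b) x.
Proof.
have [Kx|Kx] := pselect (closure [set x | u x != 0] x); last first.
  rewrite gradient_density_off//.
  have k0 (k r s : R) : 0 <= k -> 0 <= c * k * log_density r s x.
    by move=> ?; rewrite mulr_ge0 ?log_density_ge0// mulr_ge0// ltW.
  by rewrite !addr_ge0 ?k0 ?powR_ge0.
have [Ox xn0 xb] := in_support Kx.
rewrite -!mulrA -!mulrDr /gradient_density /weight mulrA mulrC.
have -> : - (p + (beta - p)) = - beta by ring.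
apply: ler_pM; last exact: hardy_test_gradient_le.
- exact/rho_ge0/ltW.
- by rewrite mulr_ge0 ?powR_ge0.
- exact: rho_le.
Qed.

(** The inequality for the test function compares [n] plateau annuli on the left
    with the same [n] annuli on the right, up to two transition annuli and an
    error of order [eps]; everything is a multiple of the mass [sigma]. *)
Lemma hardy_test_estimate : hardy_inequality p c beta A lambda u ->
  lambda * (1 - eps) * n%:R <=
  C `^ p * n%:R + 2 * (4 * L + C) `^ p + C `^ (p - 1) * eps * n.+2%:R.
Proof.
have [su cK KO K0] := Cc0_support uC.
have /andP[e0 e1] := eps0.
rewrite /hardy_inequality (integral_hardy_lhs beta A p1 c0 su KO).
rewrite (integral_hardy_gradient beta A p1 c0 su KO).
rewrite (integral_hardy_quad beta A p1 c0 su KO).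
move=> H.
set M := (4 * L + C) `^ p.
have M0 : 0 <= M by exact: powR_ge0.
have cM0 : 0 <= c * M by rewrite mulr_ge0 ?(ltW c0).
have cC0 : 0 <= c * C `^ p by rewrite mulr_ge0 ?powR_ge0 ?(ltW c0).
have ce0 : 0 <= c * (1 - eps) by rewrite mulr_ge0 ?(ltW c0)// subr_ge0.
have ec0 : 0 <= eps * c by rewrite mulr_ge0 ?(ltW c0).
have lower : ((lambda * (c * (1 - eps) * (n%:R * sigma)))%:E <=
    lambda%:E * \int[leb]_x (F x)%:E)%E.
  rewrite EFinM lee_wpmul2l ?lee_fin// -(integral_scaled ce0 mass_middle).
  apply: (ge0_le_integral _ measurableT _ (measurable_scaled _ _ _)).
  - by move=> x _; exact: scaled_ge0.
  - by apply/measurable_EFinP; exact: measurable_weighted_power.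
  - by move=> x _; rewrite lee_fin; exact: F_ge.
have upper_grad : (\int[leb]_x (gradient_density p c beta A u x)%:E <=
    (c * M * sigma + c * C `^ p * (n%:R * sigma) + c * M * sigma)%:E)%E.
  have -> : (c * M * sigma + c * C `^ p * (n%:R * sigma) + c * M * sigma)%:E =
      (\int[leb]_x (c * M * log_density a (2 * a) x)%:E
       + \int[leb]_x (c * C `^ p * log_density (2 * a) b x)%:E
       + \int[leb]_x (c * M * log_density b (2 * b) x)%:E)%E.
    rewrite (integral_scaled cM0 (mass_double a0)) (integral_scaled cC0 mass_middle).
    by rewrite (integral_scaled cM0 (mass_double b0)) -!EFinD.
  have m12 : measurable_fun setT (fun x : 'rV[R]_d =>
     ((c * M * log_density a (2 * a) x)%:E + (c * C `^ p * log_density (2 * a) b x)%:E)%E).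
    by apply: emeasurable_funD; exact: measurable_scaled.
  rewrite -(ge0_integralD _ measurableT
    (fun x _ => scaled_ge0 a (2 * a) x cM0) (measurable_scaled _ _ _)
    (fun x _ => scaled_ge0 (2 * a) b x cC0) (measurable_scaled _ _ _)).
  rewrite -(ge0_integralD _ measurableT _ m12
    (fun x _ => scaled_ge0 b (2 * b) x cM0) (measurable_scaled _ _ _)); last first.
    by move=> x _; rewrite adde_ge0// scaled_ge0.
  apply: (ge0_le_integral _ measurableT).
  - by move=> x _; rewrite lee_fin; exact: gradient_density_ge0.
  - by apply/measurable_EFinP; exact: measurable_gradient_density.
  - by apply: emeasurable_funD; [exact: m12|exact: measurable_scaled].
  - by move=> x _; rewrite -!EFinD lee_fin; exact: gradient_density_le.
have upper_quad : (\int[leb]_x (quad_density p c beta A u x)%:E <=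
    (eps * c * (n.+2%:R * sigma))%:E)%E.
  rewrite -(integral_scaled ec0 mass_total).
  apply: (ge0_le_integral _ measurableT _ _ (measurable_scaled _ _ _)).
  - by move=> x _; rewrite lee_fin; exact: quad_density_ge0.
  - by apply/measurable_EFinP; exact: measurable_quad_density.
  - by move=> x _; rewrite lee_fin; exact: quad_density_le.
have kq : ((C `^ (p - 1) * Num.sg (d%:R - (p + beta)))%:E *
     \int[leb]_x (quad_density p c beta A u x)%:E <=
    (C `^ (p - 1) * (eps * c * (n.+2%:R * sigma)))%:E)%E.
  rewrite [leRHS]EFinM.
  apply: (@le_trans _ _ ((C `^ (p - 1))%:E * \int[leb]_x (quad_density p c beta A u x)%:E)%E).
    apply: lee_wpmul2r.
      by apply: integral_ge0 => x _; rewrite lee_fin; exact: quad_density_ge0.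
    rewrite lee_fin ler_piMr ?powR_ge0// (le_trans (ler_norm _))// normr_sg.
    by rewrite lern1 leq_b1.
  by apply: lee_wpmul2l; rewrite ?lee_fin ?powR_ge0.
have := le_trans lower (le_trans H (leeD upper_grad kq)).
rewrite -EFinD lee_fin => fin.
have cs0 : 0 < c * sigma by rewrite mulr_gt0.
rewrite -(ler_pM2l cs0); apply: le_trans (le_trans _ fin) _.
  by rewrite le_eqVlt; apply/orP; left; apply/eqP; ring.
by rewrite le_eqVlt; apply/orP; left; apply/eqP; ring.
Qed.

End fixed_scale.

(** Fix [eps] so small that the errors of order [eps] leave a gap between [lambda]
    and [C `^ p]; the gap, multiplied by the number [n] of annuli, eventually
    exceeds the contribution of the two transition annuli. *)
Lemma hardy_constant_optimal (lambda : R) : C `^ p < lambda ->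
  ~ (forall u : 'rV[R]_d -> R, Cc0 u -> hardy_inequality p c beta A lambda u).
Proof.
move=> Cl hardy.
have [S [S' [CS dS S01 [S_le0 S_ge1] [S'_out [L L0 S'_le]]]]] := @smooth_step_exists R.
have [sigma sigma0 sigmaE] := @integral_log_density_unit R d d_gt0.
have Cp0 : 0 <= C `^ p by exact: powR_ge0.
have Cp1 : 0 <= C `^ (p - 1) by exact: powR_ge0.
have l0 : 0 < lambda := le_lt_trans Cp0 Cl.
(* [eps] is chosen so that its total cost, with factor
   [lambda + C `^ (p - 1)], is at most half of [lambda - C `^ p] *)
pose D := 2 * (lambda + C `^ (p - 1) + 1).
have D0 : 0 < D by rewrite /D; lra.
pose eps := (lambda - C `^ p) / D.
have e0 : 0 < eps by rewrite divr_gt0// subr_gt0.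
have e1 : eps <= 1 by rewrite ler_pdivrMr// mul1r /D; lra.
have eD : eps * D = lambda - C `^ p by rewrite /eps divfK// lt0r_neq0.
have [b b0 small] := quad_small_near0 e0.
have eps01 : 0 <= eps <= 1 by rewrite (ltW e0) e1.
have estimate n : lambda * (1 - eps) * n%:R <=
    C `^ p * n%:R + 2 * (4 * L + C) `^ p + C `^ (p - 1) * eps * n.+2%:R.
  pose a := b / (2 ^+ n * 2).
  have a0 : 0 < a by rewrite divr_gt0// mulr_gt0// exprn_gt0.
  have bE : b = 2 ^+ n * (2 * a).
    by rewrite mulrA mulrC /a divfK// mulf_neq0// expf_neq0.
  apply: (hardy_test_estimate CS dS S01 S_le0 S_ge1 S'_out L0 S'_le
    a0 bE eps01 (ltW l0) small sigma0 sigmaE).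
  apply: hardy; apply: hardy_test_Cc0 => //.
  have a20 : 0 <= 2 * a by rewrite mulr_ge0// ltW.
  by rewrite [leRHS]bE ler_peMl// exprn_ege1// ler1n.
pose K := 2 * (4 * L + C) `^ p + 2 * (C `^ (p - 1) * eps).
pose n := (Num.truncn (2 * K / (lambda - C `^ p))).+1.
have ln0 : 0 < lambda - C `^ p by rewrite subr_gt0.
have nK : 2 * K < (lambda - C `^ p) * n%:R.
  by rewrite [ltRHS]mulrC -ltr_pdivrMr// /n; exact: truncnS_gt.
have := estimate n.
have -> : n.+2%:R = n%:R + 2 :> R by rewrite -addn2 natrD.
have half : (lambda - C `^ p) / 2 <= lambda * (1 - eps) - C `^ p - C `^ (p - 1) * eps.
  move: eD; rewrite /D => eD; nra.
have n0 : 0 <= n%:R :> R by [].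
have := ler_wpM2r n0 half.
rewrite /K in nK *; nra.
Qed.

End optimality.

Unset Implicit Arguments.
Set Strict Implicit.

Theorem theorem3p2 (R : realType) (d : nat) (p c beta : R) (A : 'M[R]_d)
    (d_ge1 : (1 <= d)%N) (p_gt1 : 1 < p) (c_gt0 : 0 < c) (A_psd : possemidefmx A) :
  (forall u : 'rV[R]_d -> R, Cc0 u ->
     hardy_inequality p c beta A (hardy_constant d p beta `^ p) u) /\
  (A = 0 \/ posdefmx A ->
     forall lambda : R, hardy_constant d p beta `^ p < lambda ->
       ~ (forall u : 'rV[R]_d -> R, Cc0 u ->
            hardy_inequality p c beta A lambda u)).
Proof.
have [_ A_ge0] := A_psd; split=> [u /(Cc0_support d_ge1) [su cK KO K0]|_ lambda].
  exact: hardy_inequality_on_Omega.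
exact: hardy_constant_optimal.
Qed.
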